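(* Let $G$ be a tree on a vertex set $V$ with $n=|V|\geq 5$, and let $T$ be its set of connected triples. Then $G$ is the unique tree on vertex set $V$ whose set of connected triples is $T$, and there is an algorithm that, given $T$ (and the knowledge that the underlying graph is a tree), reconstructs $G$ in $O(|T|)$ time.
   Context: For a graph $G$, a connected triple is a $3$-element subset $\{a,b,c\}\subseteq V(G)$ such that the induced subgraph $G[\{a,b,c\}]$ is connected. Graphs are labelled: two graphs on the same vertex set are equal iff they have the same edge set. *)

(* Defs.v *)
From HB Require Import structures.
From mathcomp Require Import all_boot.

Set Implicit Arguments.
Unset Strict Implicit.
Unset Printing Implicit Defensive.

Record sgraph (V : finType) := SGraph {
  edges : {set {set V}};
  edges_card2 : [forall e in edges, #|e| == 2]
}.

Lemma sgraph_inj (V : finType) (G H : sgraph V) : edges G = edges H -> G = H.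
Proof.
case: G H => [E hE] [F hF] /= eqEF; case: F / eqEF hF => hF.
by congr SGraph; apply: bool_irrelevance.
Qed.

Definition adj (V : finType) (G : sgraph V) : rel V :=
  fun x y => [set x; y] \in edges G.

Definition connected (V : finType) (G : sgraph V) : bool :=
  (0 < #|V|) && [forall x, forall y, connect (adj G) x y].

Definition acyclic (V : finType) (G : sgraph V) : Prop :=
  forall c : seq V, 2 < size c -> ~ ucycle (adj G) c.

Definition is_tree (V : finType) (G : sgraph V) : Prop :=
  connected G /\ acyclic G.

Definition induced_edges (V : finType) (G : sgraph V) (S : {set V}) :
    {set {set {x : V | x \in S}}} :=
  [set e : {set {x : V | x \in S}} | [set val x | x in e] \in edges G].

Lemma induced_edges_card2 (V : finType) (G : sgraph V) (S : {set V}) :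
  [forall e in induced_edges G S, #|e| == 2].
Proof.
apply/forall_inP => e; rewrite inE => he.
have /forall_inP/(_ _ he) := edges_card2 G.
by rewrite card_imset //; apply: val_inj.
Qed.

Definition induced (V : finType) (G : sgraph V) (S : {set V}) :
    sgraph {x : V | x \in S} :=
  SGraph (induced_edges_card2 G S).

Definition connected_triples (V : finType) (G : sgraph V) : {set {set V}} :=
  [set t : {set V} | (#|t| == 3) && connected (induced G t)].

(* Random access machine of Cook and Reckhow with uniform cost, on natural
   numbers: subtraction is truncated.  [Jpos l j] jumps to line [l] if register
   [j] is positive; the machine halts when the program counter leaves the
   program.  Reading from an exhausted input tape yields 0. *)
Inductive instr :=
  | Const of nat & nat
  | Add of nat & nat & nat
  | Sub of nat & nat & nat
  | LoadInd of nat & nat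
  | StoreInd of nat & nat
  | Jpos of nat & nat
  | Read of nat
  | Print of nat.

Record config := Config {
  pc : nat;
  mem : nat -> nat;
  inp : seq nat;
  out : seq nat
}.

Definition init (input : seq nat) : config := Config 0 (fun=> 0) input [::].

Definition upd (m : nat -> nat) (a v : nat) : nat -> nat :=
  fun b => if b == a then v else m b.

Definition set_reg (st : config) (a v : nat) : config :=
  Config (pc st).+1 (upd (mem st) a v) (inp st) (out st).

Definition exec (i : instr) (st : config) : config :=
  let m := mem st in
  match i with
  | Const r c => set_reg st r c
  | Add r j k => set_reg st r (m j + m k)
  | Sub r j k => set_reg st r (m j - m k)
  | LoadInd r j => set_reg st r (m (m j))
  | StoreInd r j => set_reg st (m r) (m j)
  | Jpos l j => Config (if 0 < m j then l else (pc st).+1) m (inp st) (out st)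
  | Read r => Config (pc st).+1 (upd m r (head 0 (inp st)))
                     (behead (inp st)) (out st)
  | Print r => Config (pc st).+1 m (inp st) (rcons (out st) (m r))
  end.

Definition step (p : seq instr) (st : config) : config :=
  if onth p (pc st) is Some i then exec i st else st.

Definition run (p : seq instr) (input : seq nat) (k : nat) : config :=
  iter k (step p) (init input).

(* Halting configurations are fixed by [step], so the first two clauses say that
   the machine halts after at most [time] steps.  The last clause makes this a
   machine with words of about [log2 word] bits: without it, unit-cost addition
   could build exponentially large numbers in linear time. *)
Definition computes_within (p : seq instr) (time word : nat)
    (input output : seq nat) : Prop :=
  [/\ size p <= pc (run p input time),
      out (run p input time) = output
    & forall k a, mem (run p input k) a <= word].

(* [ss] lists every member of [F] exactly once, in any order, and every member
   by its elements without repetition, in any order. *)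
Definition listing (V : finType) (F : {set {set V}}) (ss : seq (seq V)) : Prop :=
  all uniq ss /\ perm_eq [seq [set x in s] | s <- ss] (enum F).

Definition encode (V : finType) (lab : V -> nat) (ss : seq (seq V)) : seq nat :=
  map lab (flatten ss).

(* One program and one constant serve all trees on at least 5 vertices.  The
   vertices are named 0, ..., n - 1 by an arbitrary bijection [lab].  The input
   is |T| followed by the 3|T| names occurring in a list of the triples in T; the
   output is a list of the edges, as pairs of names. *)
Definition reconstructs_in_linear_time (p : seq instr) : Prop :=
  exists c : nat,
  forall (V : finType) (G : sgraph V) (lab : V -> nat) (ts : seq (seq V)),
    is_tree G -> 5 <= #|V| ->
    injective lab -> (forall v, lab v < #|V|) ->
    listing (connected_triples G) ts ->
    exists2 es : seq (seq V), listing (edges G) es &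
      computes_within p (c * #|connected_triples G|) (c * #|connected_triples G|)
        (size ts :: encode lab ts) (encode lab es).

(* Main.v *)
Require Import Defs.
From mathcomp Require Import all_boot zify.

Set Implicit Arguments.
Unset Strict Implicit.
Unset Printing Implicit Defensive.

(** In a tree, two vertices at distance 2 lie in exactly one common connected
    triple (otherwise there is a 4-cycle), so a pair lying in at least two triples
    is an edge.  An edge lying in a single triple joins a leaf [x] to a vertex [y]
    of degree 2; then [x] lies in a single triple [{x, y, z}].  All triples through
    [y] contain [z], and since there are at least 5 vertices some triple contains
    [z] but not [y].  Hence, among the two companions of a vertex lying in exactly
    one triple, its neighbour is the one lying in fewer triples.  This describes
    the edges in terms of the triples alone.

    The algorithm builds, for each vertex [v], the linked list of the triples
    through [v].  Traversing it twice, it counts in an array how often each other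
    vertex occurs, then prints the vertices [x > v] that occur at least twice and
    clears the array; if the list has length 1 it also prints the companion with
    the shorter list.  The lists have total length [3|T|], and every vertex lies in
    a triple, so that letting [v] range over all numbers below [3|T|] covers all
    vertices in linear time.  The RAM program is compiled from a small structured
    language with arrays, for which weakest-precondition rules that count steps are
    proved. *)

(** * Trees are determined by their connected triples *)

Section Adjacency.
Variables (V : finType) (G : sgraph V).
Implicit Types x y z : V.

Lemma adjC x y : adj G x y = adj G y x.
Proof. by rewrite /adj setUC. Qed.

Lemma adj_neq x y : adj G x y -> x != y.
Proof.
move=> h; have /forall_inP/(_ _ h) := edges_card2 G.
by rewrite cards2; case: (x != y).
Qed.

(** Without such an edge, [S] would be closed under adjacency, hence under [connect], and could not
    separate [x] from [y]. *)
Lemma connected_cut (S : {set V}) x y : connected G -> x \in S -> y \notin S ->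
  exists u v, [/\ u \in S, v \notin S & adj G u v].
Proof.
case/andP => _ /forallP/(_ x)/forallP/(_ y) cxy xS yS.
case: (boolP [exists u, exists v, [&& u \in S, v \notin S & adj G u v]]).
  by case/existsP => u /existsP[v /and3P[]]; exists u, v.
move=> /existsPn noE; suff cl: closed (adj G) (mem S).
  by have := closed_connect cl cxy; rewrite xS (negPf yS).
move=> u v auv.
have /existsPn/(_ v) := noE u; have /existsPn/(_ u) := noE v.
rewrite auv adjC auv !andbT /=.
by case: (u \in S); case: (v \in S).
Qed.

Lemma adj_induced (S : {set V}) (x y : {x : V | x \in S}) :
  adj (induced G S) x y = adj G (val x) (val y).
Proof. by rewrite /adj /= inE imsetU1 imset_set1. Qed.

End Adjacency.

Lemma cards3_eq (T : finType) (a b c : T) :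
  a != b -> a != c -> b != c -> #|[set a; b; c]| = 3.
Proof.
by move=> ab ac bc; rewrite setUC cardsU1 cards2 !inE ab negb_or eq_sym ac eq_sym bc.
Qed.

Lemma cards3P (T : finType) (A : {set T}) : #|A| = 3 ->
  exists a b c, [/\ a != b, a != c, b != c & A = [set a; b; c]].
Proof.
move=> A3; have /card_gt2P[a [b [c [[aA bA cA] [ab bc ca]]]]] : 2 < #|A| by rewrite A3.
exists a, b, c; split=> //; first by rewrite eq_sym.
apply/esym/eqP; rewrite eqEcard cards3_eq // ?A3 1?eq_sym // leqnn andbT.
by apply/subsetP => x; rewrite !inE -orbA => /or3P[] /eqP->.
Qed.

Lemma set3_rot (T : finType) (a b c : T) : [set a; b; c] = [set c; a; b].
Proof. by rewrite setUC setUA. Qed.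

Lemma set3_swap (T : finType) (a b c : T) : [set a; b; c] = [set a; c; b].
Proof. by rewrite -!setUA [[set b] :|: _]setUC. Qed.

(** * Connected triples as paths; excluded short cycles *)

Section Triples.
Variables (V : finType) (G : sgraph V).

(** Connectivity gives every vertex of the triple a neighbour in it. The edge found at [a] and an
    edge at the vertex it misses share an endpoint, so they form a path, whose midpoint is the [b]
    of the statement. *)
Lemma connected_triplesP (t : {set V}) :
  reflect (exists a b c, [/\ a != c, adj G a b, adj G b c & t = [set a; b; c]])
          (t \in connected_triples G).
Proof.
apply: (iffP idP); last first.
  case=> a [b [c [ac ab bc ->]]].
  have bS : b \in [set a; b; c] by rewrite !inE eqxx orbT.
  pose b' : {x : V | x \in [set a; b; c]} := exist _ b bS.
  rewrite inE cards3_eq ?(adj_neq ab) ?(adj_neq bc) //=.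
  have cb x : connect (adj (induced G [set a; b; c])) x b'.
    have : (x == b') || adj (induced G [set a; b; c]) x b'.
      rewrite adj_induced -val_eqE /=; have := valP x; rewrite !inE.
      by case/orP => [/orP[]|] /eqP ->; rewrite ?ab ?eqxx ?(adjC G c) ?bc ?orbT.
    by case/orP => [/eqP->|/connect1].
  have csym : connect_sym (adj (induced G [set a; b; c])).
    by apply: sym_connect_sym => x y; rewrite !adj_induced adjC.
  apply/andP; split; first by apply/card_gt0P; exists b'.
  by apply/forallP => x; apply/forallP => y; apply: connect_trans (cb x) _; rewrite csym.
rewrite inE => /andP[/eqP/cards3P[a [b [c [anb anc bnc ->]]]] conn].
set S := [set a; b; c] in conn *.
have nb x y : x \in S -> y \in S -> x != y -> exists2 z, z \in S & adj G x z.
  move=> xS yS xny.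
  have y'P : (exist _ y yS : {x | x \in S}) \notin [set exist _ x xS].
    by rewrite inE -val_eqE /= eq_sym.
  have [u [v [/set1P-> _]]] := connected_cut conn (set11 _) y'P.
  by rewrite adj_induced /= => h; exists (val v) => //; apply: valP.
have [aS bS cS] : [/\ a \in S, b \in S & c \in S] by rewrite !inE !eqxx ?orbT.
have [d] := nb a b aS bS anb; rewrite !inE -orbA => /or3P[] /eqP-> ad.
- by have := adj_neq ad; rewrite eqxx.
- rewrite eq_sym in anc; have [e] := nb c a cS aS anc.
  rewrite !inE -orbA => /or3P[] /eqP-> ce.
  + exists c, a, b; split; rewrite // 1?eq_sym //.
    by apply/setP => x; rewrite !inE -!orbA; do !bool_congr.
  + by exists a, b, c; rewrite eq_sym anc ad adjC.
  + by have := adj_neq ce; rewrite eqxx.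
- rewrite eq_sym in anb; have [e] := nb b a bS aS anb.
  rewrite !inE -orbA => /or3P[] /eqP-> be.
  + exists b, a, c; split; rewrite //.
    by apply/setP => x; rewrite !inE -!orbA; do !bool_congr.
  + by have := adj_neq be; rewrite eqxx.
  + exists a, c, b; split; rewrite // 1?adjC // 1?eq_sym //.
    by apply/setP => x; rewrite !inE -!orbA; do !bool_congr.
Qed.

Lemma mem_triple a b c : a != c -> adj G a b -> adj G b c ->
  [set a; b; c] \in connected_triples G.
Proof. by move=> *; apply/connected_triplesP; exists a, b, c. Qed.

Lemma acyclic_triangle a b c : acyclic G ->
  adj G a b -> adj G b c -> adj G c a -> False.
Proof.
move=> ac ab bc ca; apply: (ac [:: a; b; c]) => //; rewrite /ucycle /= ab bc ca /=.
by rewrite !inE negb_or (adj_neq ab) (adj_neq bc) eq_sym (adj_neq ca).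
Qed.

Lemma acyclic_square a b c d : acyclic G -> a != c -> b != d ->
  adj G a b -> adj G b c -> adj G c d -> adj G d a -> False.
Proof.
move=> ac anc bnd ab bc cd da; apply: (ac [:: a; b; c; d]) => //.
rewrite /ucycle /= ab bc cd da /= !inE !negb_or (adj_neq ab) (adj_neq bc).
by rewrite (adj_neq cd) anc bnd eq_sym (adj_neq da).
Qed.

End Triples.

(** * Recognizing edges by counting triples *)

Section Recognition.
Variable V : finType.
Implicit Types (T : {set {set V}}) (x y z : V).

Definition tdeg T x := #|[set t in T | x \in t]|.
Definition codeg T x y := #|[set t in T | (x \in t) && (y \in t)]|.

(** Meant to say that [x] is a leaf and [y] the vertex of degree 2 next to it. *)
Definition pendant T x y :=
  (tdeg T x == 1) && [exists z, ([set x; y; z] \in T) && (tdeg T y < tdeg T z)].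

Lemma codegC T x y : codeg T x y = codeg T y x.
Proof. by apply: eq_card => t; rewrite !inE (andbC (x \in t)). Qed.

Lemma codeg_le T x y : codeg T x y <= tdeg T x.
Proof. by apply/subset_leq_card/subsetP => t; rewrite !inE => /and3P[-> ->]. Qed.

Variable G : sgraph V.
Hypotheses (treeG : is_tree G) (V5 : 5 <= #|V|).
Local Notation T := (connected_triples G).

(** The bound on [#|V|] enters the recognition here: fewer than 5 vertices leave one out, so
    connectivity yields an edge leaving [S]. *)
Lemma tree_cut (S : {set V}) x : x \in S -> #|S| < 5 ->
  exists u v, [/\ u \in S, v \notin S & adj G u v].
Proof.
move=> xS S5; have [y yS] : exists y, y \notin S.
  apply/existsP; rewrite -negb_forall; apply: contraL S5 => /forallP all_S.
  rewrite -leqNgt (leq_trans V5) //; apply/subset_leq_card/subsetP => y _.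
  exact: all_S.
by apply: connected_cut xS yS; case: treeG.
Qed.

(** Since [[set x; y; z]] is the only triple containing both [x] and [y], [x] has no neighbour but
    [y], and [y] none but [x] and [z]. So each triple through [y] contains [z], and two further
    vertices give a triple through [z] that avoids [y]. *)
Lemma degree2_leaf_edge x y z : adj G x y -> adj G y z -> x != z ->
  codeg T x y <= 1 -> [/\ tdeg T x == 1, tdeg T y < tdeg T z & 1 < tdeg T y].
Proof.
move=> xy yz xnz /card_le1_eqP cod; have [_ acG] := treeG.
have xny := adj_neq xy; have ynz := adj_neq yz.
have xyz : [set x; y; z] \in T by apply: mem_triple.
have third w : w != x -> w != y -> [set x; y; w] \in T -> w = z.
  move=> wx wy xyw.
  have /setP/(_ w) : [set x; y; w] = [set x; y; z].
    by apply: cod; rewrite in_set ?xyw ?xyz !(in_setU, in_set1) !eqxx ?orbT.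
  by rewrite !inE eqxx (negPf wx) (negPf wy) /= => /esym/eqP.
have Nx w : adj G x w -> w = y.
  move=> xw; apply/eqP; apply: contraT => wy.
  have wx : w != x by rewrite eq_sym (adj_neq xw).
  have wz : w = z.
    by apply: third => //; rewrite set3_rot; apply: mem_triple; rewrite // adjC.
  by case: (acyclic_triangle acG xy yz); rewrite adjC -wz.
have Ny w : adj G y w -> w = x \/ w = z.
  move=> yw; have [->|wx] := eqVneq w x; [by left | right].
  apply: third => //; first by rewrite eq_sym (adj_neq yw).
  by apply: mem_triple; rewrite // eq_sym.
have tx : [set t in T | x \in t] = [set [set x; y; z]].
  apply/setP => t; rewrite in_set1 in_set; apply/andP/eqP; last first.
    by move=> ->; rewrite xyz !(in_setU, in_set1) eqxx.
  case=> /connected_triplesP[a [b [c [ac ab bc ->]]]].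
  rewrite !inE -orbA => /or3P[] /eqP E; subst.
  - have Eb := Nx _ ab; subst b.
    by case: (Ny _ bc) => Ec; subst; rewrite ?eqxx in ac *.
  - rewrite adjC in ab; have Ea := Nx _ ab; have Ec := Nx _ bc.
    by rewrite Ea Ec eqxx in ac.
  - rewrite adjC in bc; have Eb := Nx _ bc; subst b.
    rewrite adjC in ab; case: (Ny _ ab) => Ea; subst; first by rewrite eqxx in ac.
    by apply/setP => u; rewrite !inE -!orbA; do !bool_congr.
have xS : x \in [set x; y; z] by rewrite !inE eqxx.
have S3 : #|[set x; y; z]| = 3 by apply: cards3_eq.
have S5 : #|[set x; y; z]| < 5 by rewrite S3.
(* A fourth vertex [w]: as all neighbours of [x] and [y] lie in the triple, it is attached to
   [z]. *)
have [u [w [uS wS uw]]] := tree_cut xS S5.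
have zw : adj G z w.
  move: uS wS; rewrite !inE -orbA => /or3P[] /eqP E; subst u => //.
    by rewrite (Nx _ uw) eqxx orbT.
  by case: (Ny _ uw) => ->; rewrite eqxx ?orbT.
move: wS; rewrite !inE !negb_or -andbA => /and3P[wx wy wz].
have yzw : [set y; z; w] \in T by apply: mem_triple; rewrite // eq_sym.
split.
- by rewrite /tdeg tx cards1.
- suff: [set t in T | y \in t] \proper [set t in T | z \in t] by apply: proper_card.
  apply/properP; split.
    apply/subsetP => t; rewrite ![t \in [set _ in _ | _]]in_set => /andP[tT yt].
    rewrite tT /=.
    have [xt|xt] := boolP (x \in t).
      have : t \in [set t in T | x \in t] by rewrite in_set tT.
      by rewrite tx => /set1P->; rewrite !inE eqxx orbT.
    case/connected_triplesP: tT yt xt => a [b [c [ac ab bc ->]]].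
    rewrite !inE -!orbA => /or3P[] /eqP E; subst.
    + by case: (Ny _ ab) => ->; rewrite eqxx ?orbT.
    + rewrite adjC in ab; case: (Ny _ ab) => ->; rewrite eqxx ?orbT //.
    + by rewrite adjC in bc; case: (Ny _ bc) => ->; rewrite eqxx ?orbT.
  have xS4 : x \in w |: [set x; y; z] by rewrite !inE eqxx ?orbT.
  have S4 : #|w |: [set x; y; z]| < 5.
    by rewrite cardsU1 S3; case: (w \notin _).
  (* A fifth vertex [v] is attached to [w] or [z]; either way [z], [w], [v] form a triple without
     [y], which makes the inclusion strict. *)
  have [u' [v [u4 vS uv]]] := tree_cut xS4 S4.
  move: vS; rewrite !inE !negb_or -!andbA => /and4P[vw vx vy vz].
  move: u4; rewrite !inE -!orbA => /or4P[] /eqP E; subst.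
  + exists [set z; w; v].
      by rewrite in_set !in_setU !in_set1 eqxx /= andbT; apply: mem_triple; rewrite // eq_sym.
    by rewrite in_set !in_setU !in_set1 (negPf ynz) !(eq_sym y) (negPf wy) (negPf vy) andbF.
  + by rewrite (Nx _ uv) eqxx in vy.
  + by case: (Ny _ uv) => E; subst; rewrite eqxx in vx vz *.
  + exists [set w; z; v].
      rewrite in_set !in_setU !in_set1 eqxx orbT andbT.
      by apply: mem_triple; rewrite ?(adjC G w) // eq_sym.
    by rewrite in_set !in_setU !in_set1 (negPf ynz) !(eq_sym y) (negPf wy) (negPf vy) andbF.
- apply/card_gt1P; exists [set x; y; z], [set y; z; w].
  rewrite ![_ \in [set _ in _ | _]]in_set xyz yzw !(in_setU, in_set1) !eqxx !orbT.
  split=> //.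
  apply/eqP => /setP/(_ w); rewrite !inE eqxx !orbT.
  by rewrite (negPf wx) (negPf wy) (negPf wz).
Qed.

(** Some edge leaves [[set x; y]]; its endpoint there is the degree-2 vertex of [degree2_leaf_edge].
    The clause [1 < tdeg] tells the two ends apart, since the pendant end has [tdeg] equal to 1. *)
Lemma pendant_edge x y : adj G x y -> codeg T x y <= 1 ->
  (pendant T x y && (1 < tdeg T y)) || (pendant T y x && (1 < tdeg T x)).
Proof.
have side a b z : adj G a b -> adj G b z -> a != z -> codeg T a b <= 1 ->
    pendant T a b && (1 < tdeg T b).
  move=> ab bz anz /(degree2_leaf_edge ab bz anz)[ta tb ->]; rewrite /pendant ta andbT.
  by apply/existsP; exists z; rewrite tb mem_triple.
move=> xy cod; have xS : x \in [set x; y] by rewrite !inE eqxx.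
have S5 : #|[set x; y]| < 5 by rewrite cards2; case: (_ != _).
have [u [w [uS wS uw]]] := tree_cut xS S5.
move: uS wS; rewrite !inE negb_or => /orP[] /eqP E /andP[wx wy]; subst u.
  apply/orP; right; by apply: (side _ _ w); rewrite // ?(adjC G y) 1?codegC // eq_sym.
by apply/orP; left; apply: (side _ _ w); rewrite // eq_sym.
Qed.

(** If [x] and [y] are not adjacent, each common triple is a path whose midpoint is a common
    neighbour; two triples give two midpoints and thus a 4-cycle. *)
Lemma codeg_adj x y : x != y -> 1 < codeg T x y -> adj G x y.
Proof.
move=> xny /card_gt1P[t1 [t2 []]]; rewrite [t1 \in _]inE [t2 \in _]inE.
case/and3P=> t1T x1 y1 /and3P[t2T x2 y2] t12; apply: contraT => nxy.
have mid t : t \in T -> x \in t -> y \in t ->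
    exists z, [/\ t = [set x; y; z], adj G x z & adj G z y].
  case/connected_triplesP=> a [b [c [ac ab bc ->]]].
  rewrite !inE -!orbA => /or3P[] /eqP Ex /or3P[] /eqP Ey; subst;
    rewrite ?eqxx ?ab ?bc ?(adjC G b a) ?(adjC G c b) ?ab ?bc // in xny nxy *.
    by exists b; split=> //; rewrite -setUA [[set b] :|: _]setUC setUA.
  exists b; split; rewrite 1?adjC //.
  by apply/setP => u; rewrite !inE -!orbA; do !bool_congr.
have [z [E1 xz zy]] := mid _ t1T x1 y1; have [w [E2 xw wy]] := mid _ t2T x2 y2.
have zw : z != w by apply: contraNneq t12 => zw; rewrite E1 E2 zw.
by case: (acyclic_square (proj2 treeG) xny zw xz zy); rewrite adjC.
Qed.

(** Otherwise the triple is the path [x], [z], [y], and [pendant_edge] applies to the edge between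
    [x] and [z]. As [x] has no other triple, this forces [tdeg T z < tdeg T y], against the
    assumption, or [1 < tdeg T x]. *)
Lemma pendant_adj x y : pendant T x y -> adj G x y.
Proof.
case/andP=> /eqP tx /existsP[z /andP[xyz lt_yz]]; apply: contraT => nxy.
have x3 : #|[set x; y; z]| = 3 by move: xyz; rewrite inE => /andP[/eqP].
have xny : x != y by apply: contra_eqN x3 => /eqP->; rewrite setUid cards2; case: (y != z).
have xz : adj G x z.
  have [a [b [c [ac ab bc E]]]] := connected_triplesP _ _ xyz.
  have : x \in [set a; b; c] by rewrite -E !inE eqxx.
  have : y \in [set a; b; c] by rewrite -E !inE eqxx orbT.
  have : b \in [set x; y; z] by rewrite E !inE eqxx orbT.
  rewrite !inE -!orbA => /or3P[] /eqP Eb /or3P[] /eqP Ey /or3P[] /eqP Ex; subst;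
    rewrite ?eqxx ?ab ?bc ?(adjC G _ a) ?(adjC G c) ?ab ?bc // in xny nxy *.
have uniq_t t : t \in T -> x \in t -> t = [set x; y; z].
  move=> tT xt; have /card_le1_eqP h := eq_leq tx.
  by apply: h; rewrite in_set ?tT ?xt ?xyz // !(in_setU, in_set1) eqxx.
have xcod : codeg T x z <= 1 by rewrite -tx codeg_le.
case/orP: (pendant_edge xz xcod) => /andP[/andP[/eqP t1 /existsP[w /andP[Tw lt_w]]]].
  have /setP/(_ y) : [set x; z; w] = [set x; y; z].
    by apply: uniq_t => //; rewrite !inE eqxx.
  rewrite !inE eqxx orbT /= eq_sym (negPf xny) /= => /orP[/eqP yz|/eqP yw].
    by rewrite yz ltnn in lt_yz.
  by rewrite yw ltnNge ltnW in lt_yz.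
by rewrite tx.
Qed.

(** Only triples occur on the right, so this yields uniqueness as well as the edge test run by the
    program. *)
Lemma adj_recognition x y : adj G x y =
  (x != y) && [|| 1 < codeg T x y, pendant T x y | pendant T y x].
Proof.
apply/idP/andP => [xy|[xny /or3P[/(codeg_adj xny)|/pendant_adj|/pendant_adj]]] //.
  split; first exact: adj_neq xy.
  have [//|/(pendant_edge xy)/orP[]/andP[-> _]] := ltnP 1 (codeg T x y).
    by [].
  by rewrite orbT.
by rewrite adjC.
Qed.

(** Both ends would lie in a single triple, whereas [pendant_edge] puts one of them in at least two.
    Hence no edge is printed as pendant from both ends. *)
Lemma pendant_asym x y : pendant T x y -> ~~ pendant T y x.
Proof.
move=> pxy; apply/negP => pyx; have xy := pendant_adj pxy.
have /eqP tx := proj1 (andP pxy); have /eqP ty := proj1 (andP pyx).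
have cod : codeg T x y <= 1 by rewrite -tx codeg_le.
by case/orP: (pendant_edge xy cod) => /andP[_]; rewrite ?tx ?ty.
Qed.

Lemma tree_vertex_triple x : exists2 t, t \in T & x \in t.
Proof.
have S5 : #|[set x]| < 5 by rewrite cards1.
have [u [y [/set1P-> _ xy]]] := tree_cut (set11 x) S5.
have : adj G x y by []; rewrite adj_recognition => /andP[_ /or3P[]].
- case/ltnW/card_gt0P => t; rewrite inE => /and3P[tT xt _]; by exists t.
- by case/andP => _ /existsP[z /andP[tT _]]; exists [set x; y; z]; rewrite // !inE eqxx.
- by case/andP => _ /existsP[z /andP[tT _]]; exists [set y; x; z]; rewrite // !inE eqxx orbT.
Qed.

(** The triples cover [V] and have 3 elements each. This makes [3 * #|T|], computable from the
    input, an upper bound for the vertex names. *)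
Lemma card_tree_le : #|V| <= 3 * #|T|.
Proof.
rewrite mulnC; have -> : #|V| = #|cover T|.
  rewrite -cardsT; apply: eq_card => x; rewrite inE; apply/esym/bigcupP.
  by have [t] := tree_vertex_triple x; exists t.
apply: leq_trans (leq_card_cover _) _; rewrite -sum_nat_const.
by apply: leq_sum => t; rewrite inE => /andP[/eqP->].
Qed.

End Recognition.

Lemma tree_triples_inj (V : finType) (G H : sgraph V) : 5 <= #|V| ->
  is_tree G -> is_tree H -> connected_triples H = connected_triples G -> G = H.
Proof.
move=> V5 tG tH eqT; apply: sgraph_inj; apply/setP => e.
have sub2 (K : sgraph V) : e \in edges K -> exists x y, e = [set x; y].
  move=> eK; have /forall_inP/(_ _ eK)/cards2P[x [y [_ ->]]] := edges_card2 K.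
  by exists x, y.
have eqA x y : adj G x y = adj H x y by rewrite (adj_recognition tG) ?(adj_recognition tH) ?eqT.
by apply/idP/idP => eE; have [x [y E]] := sub2 _ eE; move: eE;
  rewrite E -/(adj G x y) -/(adj H x y) eqA.
Qed.

(** * A structured language compiled to the random access machine *)

Inductive atom :=
  | AConst of nat & nat
  | AAdd of nat & nat & nat
  | ASub of nat & nat & nat
  | ALoad of nat & nat & nat
  | AStore of nat & nat & nat
  | ARead of nat
  | APrint of nat.

Inductive cmd :=
  | Block of seq atom
  | Seq of cmd & cmd
  | If of nat & cmd
  | While of nat & cmd.

Record state := State {
  rg : nat -> nat;
  ar : nat -> nat -> nat;
  ip : seq nat;
  op : seq nat
}.

Definition setr (s : state) (r v : nat) : state :=
  State (upd (rg s) r v) (ar s) (ip s) (op s).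

Definition aden (a : atom) (s : state) : state :=
  match a with
  | AConst r c => setr s r c
  | AAdd r j k => setr s r (rg s j + rg s k)
  | ASub r j k => setr s r (rg s j - rg s k)
  | ALoad r i j => setr s r (ar s i (rg s j))
  | AStore i j k => State (rg s)
      (fun i' => if i' == i then upd (ar s i) (rg s j) (rg s k) else ar s i')
      (ip s) (op s)
  | ARead r => State (upd (rg s) r (head 0 (ip s))) (ar s) (behead (ip s)) (op s)
  | APrint r => State (rg s) (ar s) (ip s) (rcons (op s) (rg s r))
  end.

(* Registers of the structured language are the cells 0..15, cells 16 and 17 are
   scratch space, and eight arrays are interleaved from cell 24 on. *)
Definition addr (i j : nat) : nat := 24 + i + 8 * j.

(** The machine cannot multiply: three doublings produce [8 * j]. *)
Definition index_code (i j : nat) : seq instr :=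
  [:: Add 16 j j; Add 16 16 16; Add 16 16 16; Const 17 (24 + i); Add 16 16 17].

Definition acompile (a : atom) : seq instr :=
  match a with
  | AConst r c => [:: Const r c]
  | AAdd r j k => [:: Add r j k]
  | ASub r j k => [:: Defs.Sub r j k]
  | ALoad r i j => index_code i j ++ [:: LoadInd r 16]
  | AStore i j k => index_code i j ++ [:: StoreInd 16 k]
  | ARead r => [:: Read r]
  | APrint r => [:: Print r]
  end.

Fixpoint csize (c : cmd) : nat :=
  match c with
  | Block l => size (flatten (map acompile l))
  | Seq c1 c2 => csize c1 + csize c2
  | If r c => 3 + csize c
  | While r c => 2 + csize c + 1
  end.

(* Scratch cell 16, set to 1, turns [Jpos] into an unconditional jump. *)
Fixpoint compile (b : nat) (c : cmd) : seq instr :=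
  match c with
  | Block l => flatten (map acompile l)
  | Seq c1 c2 => compile b c1 ++ compile (b + csize c1) c2
  | If r c =>
      [:: Jpos (b + 3) r; Const 16 1; Jpos (b + 3 + csize c) 16] ++ compile (b + 3) c
  | While r c =>
      [:: Const 16 1; Jpos (b + 2 + csize c) 16] ++
      (compile (b + 2) c ++ [:: Jpos (b + 2) r])
  end.

Lemma size_compile b c : size (compile b c) = csize c.
Proof.
by elim: c b => [l|c1 IH1 c2 IH2|r c IH|r c IH] b //=; rewrite ?size_cat ?IH1 ?IH2 ?IH /=; lia.
Qed.

Definition code_at (p : seq instr) (b : nat) (l : seq instr) : Prop :=
  forall i, i < size l -> onth p (b + i) = onth l i.

Lemma code_at_cat p b l1 l2 : code_at p b (l1 ++ l2) ->
  code_at p b l1 /\ code_at p (b + size l1) l2.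
Proof.
move=> h; split=> i hi.
  by rewrite h ?size_cat ?ltn_addr // onth_cat hi.
by rewrite -addnA h ?size_cat ?ltn_add2l // onth_cat ltnNge leq_addr /= addKn.
Qed.

Lemma code_at_cons p b i l : code_at p b (i :: l) ->
  onth p b = Some i /\ code_at p b.+1 l.
Proof.
move=> h; split; first by have := h 0 isT; rewrite addn0.
by move=> k hk; rewrite addSnnS h.
Qed.

(** * Step-counting rules for compiled code *)

Section Logic.
Variable W : nat.

Definition bounded (m : nat -> nat) : Prop := forall a, m a <= W.

Lemma bounded_upd m a v : bounded m -> v <= W -> bounded (upd m a v).
Proof. by move=> bm vW b; rewrite /upd; case: eqP. Qed.

(** The bound is required at every intermediate configuration because [computes_within] limits the
    memory at all times. *)
Definition runs (p : seq instr) (st : config) (k : nat) (st' : config) : Prop :=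
  iter k (step p) st = st' /\
  forall k', k' <= k -> bounded (Defs.mem (iter k' (step p) st)).

Lemma runs0 p st : bounded (Defs.mem st) -> runs p st 0 st.
Proof. by move=> h; split=> // k'; rewrite leqn0 => /eqP->. Qed.

Lemma runs_step p b m x o k st' i : onth p b = Some i -> bounded m ->
  runs p (exec i (Config b m x o)) k st' -> runs p (Config b m x o) k.+1 st'.
Proof.
move=> pi bst [e h].
have E : step p (Config b m x o) = exec i (Config b m x o) by rewrite /step /= pi.
split; first by rewrite iterSr E.
by case=> [|k'] hk //; rewrite iterSr E; apply: h.
Qed.

Lemma runs_trans p st k1 st1 k2 st2 :
  runs p st k1 st1 -> runs p st1 k2 st2 -> runs p st (k1 + k2) st2.
Proof.
move=> [e1 h1] [e2 h2]; split; first by rewrite addnC iterD e1.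
move=> k' hk; have [/h1 //|hlt] := leqP k' k1.
by rewrite -(subnK (ltnW hlt)) iterD e1; apply: h2; lia.
Qed.

Lemma runs_bounded p st k st' : runs p st k st' -> bounded (Defs.mem st').
Proof. by case=> <-; apply. Qed.

(** Cells 16 to 23 are subject only to the word bound, so scratch writes preserve the relation. *)
Definition sim (m : nat -> nat) (s : state) : Prop :=
  [/\ forall r, r < 16 -> m r = rg s r,
      forall i j, i < 8 -> m (addr i j) = ar s i j & bounded m].

(** Side conditions that keep all cells within [W]. Array accesses bound the address, since it is
    itself stored in cell 16. *)
Definition aok (a : atom) (s : state) : bool :=
  match a with
  | AConst r c => (r < 16) && (c <= W)
  | AAdd r j k => [&& r < 16, j < 16, k < 16 & rg s j + rg s k <= W]
  | ASub r j k => [&& r < 16, j < 16 & k < 16]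
  | ALoad r i j => [&& r < 16, i < 8, j < 16 & addr i (rg s j) <= W]
  | AStore i j k => [&& i < 8, j < 16, k < 16 & addr i (rg s j) <= W]
  | ARead r => (r < 16) && (head 0 (ip s) <= W)
  | APrint r => r < 16
  end.

Lemma index_runs p b i j m x o : code_at p b (index_code i j) ->
  bounded m -> j < 16 -> addr i (m j) <= W ->
  exists m', [/\ runs p (Config b m x o) 5 (Config (b + 5) m' x o),
    m' 16 = addr i (m j) & forall a : nat, a != 16 -> a != 17 -> m' a = m a].
Proof.
rewrite /addr => /code_at_cons[h1 /code_at_cons[h2 /code_at_cons[h3
  /code_at_cons[h4 /code_at_cons[h5 _]]]]] bm j16 aW.
set m1 := upd m 16 (m j + m j).
set m2 := upd m1 16 (m1 16 + m1 16).
set m3 := upd m2 16 (m2 16 + m2 16).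
set m4 := upd m3 17 (24 + i).
set m5 := upd m4 16 (m4 16 + m4 17).
have b1 : bounded m1 by apply: bounded_upd => //; lia.
have b2 : bounded m2 by apply: bounded_upd => //; rewrite /m1 /upd /=; lia.
have b3 : bounded m3 by apply: bounded_upd => //; rewrite /m2 /m1 /upd /=; lia.
have b4 : bounded m4 by apply: bounded_upd => //; lia.
have b5 : bounded m5 by apply: bounded_upd => //; rewrite /m4 /m3 /m2 /m1 /upd /=; lia.
exists m5; split.
- do 5!(apply: runs_step; [eassumption|by []|]).
  by rewrite (addnC b); exact: (@runs0 p (Config b.+4.+1 m5 x o)).
- by rewrite /m5 /m4 /m3 /m2 /m1 /upd /=; lia.
- by move=> a /negPf h16 /negPf h17; rewrite /m5 /m4 /m3 /m2 /m1 /upd h16 h17.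
Qed.

Lemma sim_scratch m m' s : sim m s -> bounded m' ->
  (forall a : nat, a != 16 -> a != 17 -> m' a = m a) -> sim m' s.
Proof.
move=> [h1 h2 _] bm' e; split=> // [r hr|i j hi].
  by rewrite e ?h1 //; apply/eqP; lia.
by rewrite e ?h2 // /addr; apply/eqP; lia.
Qed.

Lemma sim_setr m s r v : sim m s -> r < 16 -> v <= W -> sim (upd m r v) (setr s r v).
Proof.
move=> [h1 h2 bm] r16 vW; split; last exact: bounded_upd.
  by move=> r' hr' /=; rewrite /upd; case: eqP => // _; apply: h1.
move=> i j hi; rewrite /upd; case: eqP => [|_]; last exact: h2.
by rewrite /addr; lia.
Qed.

Lemma runs_atom a p b m s : code_at p b (acompile a) -> sim m s -> aok a s ->
  exists2 m', sim m' (aden a s) &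
    runs p (Config b m (ip s) (op s)) (size (acompile a))
      (Config (b + size (acompile a)) m' (ip (aden a s)) (op (aden a s))).
Proof.
move=> ca sm; have [h1 h2 bm] := sm; case: a ca => /=.
- move=> r c /code_at_cons[hi _] /andP[r16 cW].
  have sm' := sim_setr sm r16 cW; exists (upd m r c) => //.
  apply: (runs_step hi bm); rewrite addn1; apply: runs0; by case: sm'.
- move=> r j k /code_at_cons[hi _] /and4P[r16 j16 k16 cW].
  have sm' := sim_setr sm r16 cW; eexists; first exact: sm'.
  apply: (runs_step hi bm); rewrite addn1 /= /set_reg /= !h1 //.
  by apply: runs0; case: sm'.
- move=> r j k /code_at_cons[hi _] /and3P[r16 j16 k16].
  have cW : rg s j - rg s k <= W by rewrite -h1 //; have := bm j; lia.
  have sm' := sim_setr sm r16 cW; eexists; first exact: sm'.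
  apply: (runs_step hi bm); rewrite addn1 /= /set_reg /= !h1 //.
  by apply: runs0; case: sm'.
- move=> r i j /(@code_at_cat _ _ (index_code i j) [:: LoadInd r 16])[hx].
  move=> /code_at_cons[hi _] /and4P[r16 i8 j16 aW].
  rewrite -h1 // in aW.
  have [m1 [r1 m16 e1]] := index_runs (ip s) (op s) hx bm j16 aW.
  have sm1 : sim m1 s by apply: sim_scratch sm (runs_bounded r1) e1.
  have [_ h2' bm1] := sm1.
  have cW : ar s i (rg s j) <= W by rewrite -h2.
  have sm' := sim_setr sm1 r16 cW; eexists; first exact: sm'.
  apply: (runs_trans (k2 := 1) r1); apply: (runs_step hi bm1).
  rewrite /= /set_reg /= m16 h2' // h1 // -addnS; apply: runs0; by case: sm'.
- move=> i j k /(@code_at_cat _ _ (index_code i j) [:: StoreInd 16 k])[hx].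
  move=> /code_at_cons[hi _] /and4P[i8 j16 k16 aW].
  rewrite -h1 // in aW.
  have [m1 [r1 m16 e1]] := index_runs (ip s) (op s) hx bm j16 aW.
  have sm1 : sim m1 s by apply: sim_scratch sm (runs_bounded r1) e1.
  have [h1' h2' bm1] := sm1.
  exists (upd m1 (m1 16) (m1 k)).
    rewrite m16 h1 //; split=> /=; last exact: bounded_upd.
      move=> r r16; rewrite /upd; case: eqP => [|_]; [rewrite /addr; lia | exact: h1'].
    move=> i' j' i'8; rewrite /upd; case: (eqVneq i' i) => [->|ni].
      (* Array numbers are below 8, so two addresses agree only if both array and index agree. *)
      by rewrite h1' // -h2' //; case: eqP; case: eqP; rewrite /addr //; lia.
    by rewrite -h2' //; case: eqP => //; rewrite /addr; lia.
  apply: (runs_trans (k2 := 1) r1); apply: (runs_step hi bm1).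
  rewrite /= /set_reg /= -addnS; apply: runs0; exact: bounded_upd.
- move=> r /code_at_cons[hi _] /andP[r16 cW].
  have sm' := sim_setr sm r16 cW; exists (upd m r (head 0 (ip s))).
    by case: sm' => *; split.
  apply: (runs_step hi bm); rewrite addn1; apply: runs0; by case: sm'.
- move=> r /code_at_cons[hi _] r16; exists m; first by [].
  apply: (runs_step hi bm); rewrite addn1 /= h1 //; exact: runs0.
Qed.

(** Total correctness with a budget of [t] steps. Quantifying over [p] and [b] lets the code be
    placed anywhere, which the composition rules rely on. *)
Definition wp (c : cmd) (t : nat) (s : state) (Q : state -> Prop) : Prop :=
  forall p b m, code_at p b (compile b c) -> sim m s ->
  exists k m' s', [/\ k <= t, Q s', sim m' s' &
    runs p (Config b m (ip s) (op s)) k (Config (b + csize c) m' (ip s') (op s'))].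

Lemma wp_weaken c t t' s (Q Q' : state -> Prop) : t <= t' ->
  wp c t s Q -> (forall s', Q s' -> Q' s') -> wp c t' s Q'.
Proof.
move=> tt' h hQ p b m ca sm; have [k [m' [s' [kt qs sm' r]]]] := h p b m ca sm.
by exists k, m', s'; split=> //; [apply: leq_trans kt tt' | apply: hQ].
Qed.

Lemma wp_seq c1 c2 t1 t2 s Q :
  wp c1 t1 s (fun s' => wp c2 t2 s' Q) -> wp (Seq c1 c2) (t1 + t2) s Q.
Proof.
move=> h p b m /= /code_at_cat[ca1 ca2] sm; rewrite size_compile in ca2.
have [k1 [m1 [s1 [k1t h1 sm1 r1]]]] := h p b m ca1 sm.
have [k2 [m2 [s2 [k2t q2 sm2 r2]]]] := h1 p _ m1 ca2 sm1.
exists (k1 + k2), m2, s2; split=> //; first exact: leq_add.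
by rewrite addnA; apply: runs_trans r1 r2.
Qed.

Fixpoint aoks (l : seq atom) (s : state) : Prop :=
  if l is a :: l' then aok a s /\ aoks l' (aden a s) else True.

Fixpoint adens (l : seq atom) (s : state) : state :=
  if l is a :: l' then adens l' (aden a s) else s.

(** The longest atoms, [ALoad] and [AStore], compile to 6 instructions: five for the address and one
    for the access. *)
Lemma wp_block l t s (Q : state -> Prop) : 6 * size l <= t ->
  aoks l s -> Q (adens l s) -> wp (Block l) t s Q.
Proof.
move=> lt ok q; apply: (wp_weaken lt) (fun=> id) => {t lt}.
elim: l s ok q => [|a l IH] s /=.
  move=> _ q p b m _ sm; exists 0, m, s; split=> //=.
  by rewrite addn0; apply: runs0; case: sm.
move=> [ha hl] q p b m /code_at_cat[ca1 ca2] sm.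
have [m1 sm1 r1] := runs_atom ca1 sm ha.
have [k2 [m2 [s2 [k2t q2 sm2 r2]]]] := IH _ hl q p _ m1 ca2 sm1.
exists (size (acompile a) + k2), m2, s2; split=> //; last first.
  by rewrite /= size_cat addnA; apply: runs_trans r1 r2.
by rewrite mulnS leq_add //; case: (a).
Qed.

Lemma wp_if r c t s (Q : state -> Prop) : 0 < W -> r < 16 ->
  (rg s r = 0 -> Q s) -> (0 < rg s r -> wp c t s Q) -> wp (If r c) (t + 3) s Q.
Proof.
move=> W_gt0 r16 q0 q1 p b m /= /code_at_cons[h1 /code_at_cons[h2 /code_at_cons[h3 ca]]] sm.
have [e1 e2 bm] := sm; have [r0|rp] := posnP (rg s r).
  exists 3, (upd m 16 1), s; split; [by lia|exact: q0| |].
    apply: (sim_scratch sm); first exact: bounded_upd.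
    by move=> a /negPf h _; rewrite /upd h.
  apply: (runs_step h1 bm); rewrite /= e1 // r0 ltnn.
  apply: (runs_step h2 bm); apply: runs_step h3 _ _; first exact: bounded_upd.
  by rewrite /= {1}/upd /= addnA; apply: runs0; apply: bounded_upd.
rewrite -addn3 in ca; have [k [m1 [s1 [kt qs sm1 r1]]]] := q1 rp p _ m ca sm.
exists k.+1, m1, s1; split=> //; first by lia.
by apply: (runs_step h1 bm); rewrite /= e1 // rp addnA.
Qed.

(** [n] is the number of iterations, and [f i] pays for the one after which [i] remain. Each adds
    one step for the test at the bottom; the 3 further steps are the two that jump to this test on
    entry and the final failing test. *)
Lemma wp_while r c n s (Q : state -> Prop) (Inv : nat -> state -> Prop) (f : nat -> nat) :
  0 < W -> r < 16 ->
  (forall s', Inv 0 s' -> rg s' r = 0 /\ Q s') ->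
  (forall n' s', Inv n'.+1 s' -> 0 < rg s' r /\ wp c (f n') s' (Inv n')) ->
  Inv n s -> wp (While r c) (\sum_(0 <= i < n) (f i).+1 + 3) s Q.
Proof.
move=> W_gt0 r16 inv0 invS invn p b m /=.
move=> /code_at_cons[h1 /code_at_cons[h2 /code_at_cat[ca ca3]]] sm.
rewrite size_compile in ca3; have [h3 _] := code_at_cons ca3.
rewrite -addn2 in ca; rewrite -addn2 in h3.
have loop s0 m0 : Inv n s0 -> sim m0 s0 -> exists k m' s', [/\ k <= \sum_(0 <= i < n) (f i).+1 + 1,
    Q s', sim m' s' & runs p (Config (b + 2 + csize c) m0 (ip s0) (op s0)) k
      (Config (b + (2 + csize c + 1)) m' (ip s') (op s'))].
  elim: n s0 m0 {invn} => [|n IH] s0 m0.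
    move=> /inv0[r0 q] sm0; have [e1 _ bm0] := sm0; exists 1, m0, s0; split=> //.
      by rewrite big_geq.
    by apply: (runs_step h3 bm0); rewrite /= e1 // r0 !addnA addn1; apply: runs0.
  move=> /invS[rp w] sm0; have [e1 _ bm0] := sm0.
  have [k1 [m1 [s1 [k1t i1 sm1 r1]]]] := w p _ m0 ca sm0.
  have [k2 [m2 [s2 [k2t q2 sm2 r2]]]] := IH _ _ i1 sm1.
  exists (k1 + k2).+1, m2, s2; split=> //; first by rewrite big_nat_recr //=; lia.
  apply: (runs_step h3 bm0); rewrite /= e1 // rp; exact: runs_trans r1 r2.
have [_ _ bm] := sm; have sm1 : sim (upd m 16 1) s.
  apply: (sim_scratch sm); first exact: bounded_upd.
  by move=> a /negPf h _; rewrite /upd h.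
have [k [m2 [s2 [kt q2 sm2 r2]]]] := loop _ _ invn sm1.
exists k.+2, m2, s2; split=> //; first by lia.
apply: (runs_step h1 bm); apply: runs_step h2 _ _; first exact: bounded_upd.
by rewrite /= {1}/upd.
Qed.

End Logic.

Lemma wp_computes W c t input (Q : state -> Prop) output :
  0 < W -> wp W c t (State (fun=> 0) (fun _ _ => 0) input [::]) Q ->
  (forall s, Q s -> op s = output) ->
  computes_within (compile 0 c) t W input output.
Proof.
move=> W_gt0 h hQ.
have ca : code_at (compile 0 c) 0 (compile 0 c) by [].
have sm : sim W (fun=> 0) (State (fun=> 0) (fun _ _ => 0) input [::]) by [].
have [k [m' [s' [kt q sm' [e bnd]]]]] := h _ _ _ ca sm.
(* With the program counter past the code, [step] does nothing, so output and memory persist. *)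
have stay j : k <= j -> run (compile 0 c) input j = Config (csize c) m' (ip s') (op s').
  move=> kj; rewrite /run -(subnK kj) iterD; rewrite /= add0n in e; rewrite e.
  elim: (j - k) => //= d ->; rewrite /step /= onth_default ?size_compile //.
split; first by rewrite stay //= size_compile.
- by rewrite stay // hQ.
- move=> j a; have [/ltnW jk|/stay->] := ltnP j k; first exact: bnd.
  by case: sm'.
Qed.

(** * The reconstruction program *)

Local Notation rOne := 0 (only parsing).
Local Notation rI := 1 (only parsing).
Local Notation rJ := 2 (only parsing).
Local Notation rA := 3 (only parsing).
Local Notation rB := 4 (only parsing).
Local Notation rC := 5 (only parsing).
Local Notation rH := 6 (only parsing).
Local Notation rM := 7 (only parsing).
Local Notation rP := 8 (only parsing).
Local Notation rX := 9 (only parsing).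
Local Notation rK := 10 (only parsing).
Local Notation rD := 11 (only parsing).
Local Notation rZero := 12 (only parsing).
Local Notation rY := 13 (only parsing).
Local Notation rTX := 14 (only parsing).
Local Notation rTY := 15 (only parsing).

Local Notation aHd := 0 (only parsing).
Local Notation aDg := 1 (only parsing).
Local Notation aCnt := 2 (only parsing).
Local Notation aNx := 3 (only parsing).
Local Notation aX1 := 4 (only parsing).
Local Notation aX2 := 5 (only parsing).

(* Node [rJ] of the linked list of [u], whose head is [aHd] (0 is the empty list),
   records that [u] forms a triple with [x] and [y]; [aDg] is the list length. *)
Definition push (u x y : nat) : seq atom :=
  [:: AAdd rJ rJ rOne; ALoad rH aHd u; AStore aX1 rJ x; AStore aX2 rJ y;
      AStore aNx rJ rH; AStore aHd u rJ;
      ALoad rH aDg u; AAdd rH rH rOne; AStore aDg u rH].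

Definition read_triples : cmd :=
  While rM (Seq (Block [:: ARead rA; ARead rB; ARead rC])
    (Seq (Block (push rA rB rC)) (Seq (Block (push rB rA rC)) (Seq (Block (push rC rA rB))
      (Block [:: ASub rM rM rOne]))))).

Definition count_neighbours : cmd :=
  While rP (Block [:: ALoad rX aX1 rP; ALoad rK aCnt rX; AAdd rK rK rOne; AStore aCnt rX rK;
                      ALoad rX aX2 rP; ALoad rK aCnt rX; AAdd rK rK rOne; AStore aCnt rX rK;
                      ALoad rP aNx rP]).

(** Truncated subtraction turns [x < y] into a positivity test. *)
Definition print_if (x y z : nat) : cmd :=
  Seq (Block [:: ASub rK y x]) (If rK (Block [:: APrint rI; APrint z])).

(** After subtracting 1, [rK] is positive exactly for counters of at least 2. [rZero] is never
    written and keeps its initial value 0. Comparing [rI] with [rX] reports the edge from its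
    smaller end only. *)
Definition visit (a : nat) : cmd :=
  Seq (Block [:: ALoad rX a rP; ALoad rK aCnt rX; AStore aCnt rX rZero; ASub rK rK rOne])
    (If rK (print_if rI rX rX)).

(* Resetting a counter when it is met makes each neighbour be printed only once
   and leaves [aCnt] zero for the next vertex. *)
Definition print_heavy : cmd :=
  While rP (Seq (visit aX1) (Seq (visit aX2) (Block [:: ALoad rP aNx rP]))).

(** Positivity being the only test, length 1 is recognized by the length and 2 minus the length both
    being positive. The two strict comparisons let at most one companion through. *)
Definition print_pendant : cmd :=
  Seq (Block [:: ALoad rP aHd rI; ALoad rD aDg rI])
    (If rD (Seq (Block [:: AAdd rK rOne rOne; ASub rD rK rD])
      (If rD (Seq (Block [:: ALoad rX aX1 rP; ALoad rY aX2 rP; ALoad rTX aDg rX; ALoad rTY aDg rY])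
         (Seq (print_if rTX rTY rX) (print_if rTY rTX rY)))))).

Definition process_vertex : cmd :=
  Seq (Block [:: ASub rI rI rOne; ALoad rP aHd rI])
    (Seq count_neighbours (Seq (Block [:: ALoad rP aHd rI]) (Seq print_heavy print_pendant))).

(** The number of vertices is not part of the input, so the countdown of [rI] starts from [3 * rM];
    numbers that name no vertex have empty lists. *)
Definition reconstruct : cmd :=
  Seq (Block [:: AConst rOne 1; ARead rM; AAdd rI rM rM; AAdd rI rI rM])
    (Seq read_triples (While rI process_vertex)).

(** * Linked lists in memory and a functional model of the output *)

Fixpoint lrep (x1 x2 nx : nat -> nat) (j h : nat) (l : seq (nat * nat)) : Prop :=
  if l is p :: l' then
    [/\ 0 < h <= j, x1 h = p.1, x2 h = p.2 & lrep x1 x2 nx j (nx h) l']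
  else h = 0.

(** [j] is the last allocated node. Since it bounds all nodes of the list, writes into fresh nodes
    do not affect the list. *)
Lemma lrep_ext x1 x2 nx x1' x2' nx' j j' h l :
  (forall k, k <= j -> [/\ x1' k = x1 k, x2' k = x2 k & nx' k = nx k]) -> j <= j' ->
  lrep x1 x2 nx j h l -> lrep x1' x2' nx' j' h l.
Proof.
move=> e jj'; elim: l h => [|p l IH] h //= [/andP[h0 hj] <- <- /IH h'].
by have [-> -> ->] := e h hj; rewrite h0 (leq_trans hj jj').
Qed.

Definition heap (L : nat -> seq (nat * nat)) (j : nat) (s : state) : Prop :=
  [/\ rg s rJ = j, rg s rOne = 1,
      forall v, lrep (ar s aX1) (ar s aX2) (ar s aNx) j (ar s aHd v) (L v),
      forall v, ar s aDg v = size (L v) & forall v, size (L v) <= j].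

Definition cons_link (L : nat -> seq (nat * nat)) (u : nat) (p : nat * nat) v :=
  if v == u then p :: L v else L v.

Definition unpairs (l : seq (nat * nat)) : seq nat := flatten [seq [:: p.1; p.2] | p <- l].

Lemma unpairs_cons p l : unpairs (p :: l) = [:: p.1, p.2 & unpairs l].
Proof. by []. Qed.

Lemma unpairs_cat l1 l2 : unpairs (l1 ++ l2) = unpairs l1 ++ unpairs l2.
Proof. by rewrite /unpairs map_cat flatten_cat. Qed.

Lemma size_unpairs l : size (unpairs l) = 2 * size l.
Proof. by elim: l => // p l IH; rewrite unpairs_cons /= IH; lia. Qed.

(** Testing [c] first mirrors the nesting of the three pushes, of which the one for [c] comes
    last. *)
Definition link (v : nat) (t : seq nat) : seq (nat * nat) :=
  if t is [:: a; b; c] then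
    if v == c then [:: (a, b)] else if v == b then [:: (a, c)] else
    if v == a then [:: (b, c)] else [::]
  else [::].

Definition links (ds : seq (seq nat)) (v : nat) : seq (nat * nat) :=
  flatten [seq link v t | t <- ds].

Lemma links_cons t ds v : links (t :: ds) v = link v t ++ links ds v.
Proof. by []. Qed.

(** Models the second traversal: [cnt] stands for the counter array, whose entry at [x] is cleared
    once [x] has been treated. *)
Fixpoint heavy (v : nat) (cnt : nat -> nat) (q : seq nat) : seq (nat * nat) :=
  if q is x :: q' then
    (if (1 < cnt x) && (v < x) then [:: (v, x)] else [::]) ++ heavy v (upd cnt x 0) q'
  else [::].

Lemma eq_heavy v c1 c2 q : c1 =1 c2 -> heavy v c1 q = heavy v c2 q.
Proof.
elim: q c1 c2 => //= x q IH c1 c2 e; rewrite e; congr (_ ++ _).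
by apply: IH => y; rewrite /upd e.
Qed.

Definition light (L : nat -> seq (nat * nat)) (v : nat) : seq (nat * nat) :=
  if L v is [:: p] then
    (if size (L p.1) < size (L p.2) then [:: (v, p.1)] else [::]) ++
    (if size (L p.2) < size (L p.1) then [:: (v, p.2)] else [::])
  else [::].

Definition found (L : nat -> seq (nat * nat)) (v : nat) : seq (nat * nat) :=
  heavy v (fun x => count_mem x (unpairs (L v))) (unpairs (L v)) ++ light L v.

Fixpoint all_found (L : nat -> seq (nat * nat)) (n : nat) : seq (nat * nat) :=
  if n is n'.+1 then found L n' ++ all_found L n' else [::].

Lemma eq_heap L L' j s : L =1 L' -> heap L j s -> heap L' j s.
Proof. by move=> e [h1 h2 h3 h4 h5]; split=> // v; rewrite -e. Qed.

(* The registers and arrays that the processing of a vertex leaves unchanged. *)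
Definition same (s s' : state) : Prop :=
  [/\ rg s' rOne = rg s rOne, rg s' rI = rg s rI, rg s' rJ = rg s rJ,
      rg s' rZero = rg s rZero & forall i, i != aCnt -> ar s' i = ar s i].

Lemma same_trans s1 s2 s3 : same s1 s2 -> same s2 s3 -> same s1 s3.
Proof.
move=> [a1 a2 a3 a4 a5] [b1 b2 b3 b4 b5]; split; rewrite ?(b1, b2, b3, b4) //.
by move=> i hi; rewrite b5 // a5.
Qed.

Lemma heap_same L j s s' : same s s' -> heap L j s -> heap L j s'.
Proof.
by move=> [e0 _ e2 _ ea] [h1 h2 h3 h4 h5]; split; rewrite ?e0 ?e2 ?ea.
Qed.

(** * Specifications and step counts of the parts of the program *)

Section Program.
Variable B : nat.
(** Every address [24 + i + 8 * j] with [i < 8] and [j <= B] is below this value. *)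
Let W := 32 + 8 * B.

(** 54 is nine atoms at 6 steps. Operands from 3 to 5 are [rA], [rB], [rC], which do not clash with
    [rJ] and [rH]. *)
Lemma wp_push L j s u x y : heap L j s -> j < B -> rg s u <= B ->
  3 <= u < 6 -> 3 <= x < 6 -> 3 <= y < 6 ->
  wp W (Block (push u x y)) 54 s (fun s' =>
    [/\ heap (cons_link L (rg s u) (rg s x, rg s y)) j.+1 s',
        forall r : nat, r != rJ -> r != rH -> rg s' r = rg s r,
        ar s' aCnt = ar s aCnt, ip s' = ip s & op s' = op s]).
Proof.
move=> [hj h1 hl hd hs] jB uB hu hx hy.
have [u2 u6] : (u == rJ) = false /\ (u == rH) = false by lia.
have [x2 x6] : (x == rJ) = false /\ (x == rH) = false by lia.
have [y2 y6] : (y == rJ) = false /\ (y == rH) = false by lia.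
apply: wp_block => //.
  rewrite /= /addr /upd /= ?(u2, u6, x2, x6, y2, y6) /= hj h1 hd.
  have := hs (rg s u); rewrite /W; lia.
split=> //; last first.
  by move=> r /negPf r2 /negPf r6; rewrite /= /upd r2 r6.
rewrite /heap /= /upd /= ?(u2, u6, x2, x6, y2, y6) /= hj h1 hd addn1.
split=> // v; rewrite /cons_link; case: (eqVneq v (rg s u)) => [->|nv] /=.
- rewrite !eqxx !leqnn; split=> //.
  (* Only the fresh node [j.+1] is written, and older lists stay within nodes up to [j]. *)
  apply: lrep_ext (hl _) => // k kj; suff -> : (k == j.+1) = false by [].
  by apply/eqP; lia.
- apply: lrep_ext (hl _) => // k kj; suff -> : (k == j.+1) = false by [].
  by apply/eqP; lia.
- by rewrite addn1.
- exact: hd.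
- exact: hs.
- exact: leqW.
Qed.

Lemma wp_read_triples (ts : seq (seq nat)) s : 3 * size ts <= B ->
  all (fun t => [&& size t == 3, uniq t & all (geq B) t]) ts ->
  heap (fun=> [::]) 0 s -> rg s rM = size ts -> ip s = flatten ts ->
  wp W read_triples (size ts * 187 + 3) s (fun s' =>
    [/\ heap (links (rev ts)) (3 * size ts) s', rg s' rI = rg s rI,
        rg s' rZero = rg s rZero, ar s' aCnt = ar s aCnt & op s' = op s]).
Proof.
move=> tsB tsP hp0 hM hip.
(* [ds] holds the triples read so far, latest first, and [td] those to come; hence [rev ts] in the
   conclusion. *)
pose Inv n s' := exists ds td : seq (seq nat), [/\ catrev td ds = rev ts, size td = n,
   ip s' = flatten td, heap (links ds) (3 * size ds) s' &
   [/\ rg s' rM = n, rg s' rI = rg s rI, rg s' rZero = rg s rZero,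
       ar s' aCnt = ar s aCnt & op s' = op s]].
apply: (@wp_weaken _ _ (\sum_(0 <= i < size ts) 186.+1 + 3)) (fun=> id).
  by rewrite sum_nat_const_nat subn0.
apply: (wp_while (Inv := Inv)) => //; last by exists [::], ts.
  move=> s' [ds [[|? ?] [/= e // _ _ hp [-> ? ? ? ?]]]].
  by rewrite e size_rev in hp.
move=> n s' [ds [[|t td] [e // [sz] hi hp [hM' hI hZ hc ho]]]].
have szs : (size td).+1 + size ds = size ts.
  by move: (congr1 size e); rewrite catrevE size_cat !size_rev /=; lia.
have : all (fun t => [&& size t == 3, uniq t & all (geq B) t]) (catrev (t :: td) ds).
  by rewrite e all_rev.
rewrite catrevE all_cat all_rev => /andP[/andP[/and3P[t3 tu tB] _] _].
case: t t3 tu tB hi e => [|a [|b [|c [|]]]] // _.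
rewrite /= !inE negb_or => /and3P[/andP[/negPf ab /negPf ac] /negPf bc _] /and4P[aB bB cB _] hi e.
split; first by rewrite hM'.
apply: (@wp_weaken _ _ (18 + (54 + (54 + (54 + 6))))) (fun=> id) => //.
apply: wp_seq; apply: wp_block => //.
  by rewrite /= hi /= /W; lia.
set s1 := adens _ _.
have [r3 r4 r5] : [/\ rg s1 rA = a, rg s1 rB = b & rg s1 rC = c].
  by rewrite /s1 /= hi.
have r7 : rg s1 rM = n.+1 by rewrite -hM'.
have i1 : ip s1 = flatten td by rewrite /s1 /= hi.
have hp1 : heap (links ds) (3 * size ds) s1 := hp.
have o1 : op s1 = op s by rewrite -ho.
have c1 : ar s1 aCnt = ar s aCnt by rewrite -hc.
have I1 : rg s1 rI = rg s rI by rewrite -hI.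
have Z1 : rg s1 rZero = rg s rZero by rewrite -hZ.
clearbody s1; clear hi hp hM' hc ho hI hZ s'.
apply: wp_seq; apply: wp_weaken (leqnn _) (wp_push hp1 _ _ _ _ _) _ => //; [lia|lia|].
move=> s2 [hp2 R2 c2 i2 o2]; apply: wp_seq.
apply: wp_weaken (leqnn _) (wp_push hp2 _ _ _ _ _) _ => //; [lia|by rewrite R2 //; lia|].
move=> s3 [hp3 R3 c3 i3 o3]; apply: wp_seq.
apply: wp_weaken (leqnn _) (wp_push hp3 _ _ _ _ _) _ => //; [lia|by rewrite R3 // R2 //; lia|].
move=> s4 [hp4 R4 c4 i4 o4]; apply: wp_block => //.
exists ([:: a; b; c] :: ds), td; split=> //.
- by rewrite /= i4 i3 i2.
- have -> : 3 * size ([:: a; b; c] :: ds) = (3 * size ds).+3 by rewrite /=; lia.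
  apply: (@eq_heap _ _ _ s4) hp4 => v.
  rewrite !R3 // !R2 // r3 r4 r5 links_cons /cons_link /=.
  case: (eqVneq v c) => [->|vc]; first by rewrite eq_sym bc eq_sym ac.
  case: (eqVneq v b) => [->|vb]; first by rewrite eq_sym ab.
  by case: (eqVneq v a).
- have [_ one4 _ _ _] := hp4.
  by rewrite /= /upd /= c4 c3 c2 one4 !R4 // !R3 // !R2 // r7 o4 o3 o2 subn1; split.
Qed.

Definition small (p : nat * nat) : bool := (p.1 <= B) && (p.2 <= B).

Lemma wp_count_neighbours L j s l : heap L j s -> j <= B ->
  lrep (ar s aX1) (ar s aX2) (ar s aNx) j (rg s rP) l -> all small l ->
  size l <= B -> (forall x, ar s aCnt x = 0) ->
  wp W count_neighbours (size l * 55 + 3) s (fun s' =>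
    [/\ same s s', op s' = op s & forall x, ar s' aCnt x = count_mem x (unpairs l)]).
Proof.
move=> hp jB lr ls lB c0.
(* Counters so far plus occurrences still ahead make the final counts. *)
pose Inv n s' := exists l', [/\ size l' = n, same s s', op s' = op s,
   lrep (ar s aX1) (ar s aX2) (ar s aNx) j (rg s' rP) l' &
   all small l' /\ forall x, ar s' aCnt x + count_mem x (unpairs l') = count_mem x (unpairs l)].
apply: (@wp_weaken _ _ (\sum_(0 <= i < size l) 54.+1 + 3)) (fun=> id).
  by rewrite sum_nat_const_nat subn0.
apply: (wp_while (Inv := Inv)) => //; last first.
- by exists l; split=> //; split=> // x; rewrite c0.
- move=> n s' [[|[x y] l'] [// [sz] sm ho [/andP[h0 hj] ex ey lr'] [/andP[/andP[xB yB] ls'] hc]]].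
  rewrite /= in ex ey xB yB.
  split=> //; have [e0 e1 e2 e12 ea] := sm; have [_ one _ _ _] := hp.
  have cW z : ar s' aCnt z <= 2 * B.
    apply: leq_trans (leq_addr (count_mem z (unpairs ((x, y) :: l'))) _) _.
    by rewrite hc (leq_trans (count_size _ _)) // size_unpairs leq_mul2l.
  apply: wp_block => //.
    rewrite /= /addr /upd /= !(ea aX1, ea aX2, ea aNx) // e0 one ex ey.
    by have := cW x; have := cW y; case: (y == x); rewrite /W; lia.
  exists l'; split=> //.
    by apply: (same_trans sm); split=> // -[|[|[|]]].
    by rewrite /= /upd /= ea.
  split=> // z; rewrite -hc unpairs_cons /= /upd /= !(ea aX1, ea aX2) // e0 one ex ey.
  rewrite (eq_sym x z) (eq_sym y z).
  by case: (eqVneq z y) => [->|_]; case: eqVneq => [->|_]; lia.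
- move=> s' [[|? ?] [// _ sm ho r0 [_ hc]]]; split=> //; split=> // x.
  by rewrite -hc addn0.
Qed.

Lemma wp_print_if x y z s : x < 16 -> y < 16 -> z < 16 -> z != rK ->
  wp W (print_if x y z) 21 s (fun s' =>
    [/\ forall r : nat, r != rK -> rg s' r = rg s r, ar s' = ar s &
        op s' = op s ++ unpairs (if rg s x < rg s y then [:: (rg s rI, rg s z)] else [::])]).
Proof.
move=> x16 y16 z16 /negPf zK; apply: (@wp_seq _ _ _ 6 15); apply: wp_block => //.
  by rewrite /= x16 y16.
apply: (@wp_if _ _ _ 12) => //; rewrite /= /upd /= => h.
  split=> // [r /negPf|]; first by rewrite /upd => ->.
  by rewrite ltnNge -subn_eq0 h eqxx cats0.
apply: wp_block => //.
split=> // [r /negPf|]; first by rewrite /= /upd => ->.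
by rewrite -subn_gt0 h /= /upd zK /= -!cats1 -catA.
Qed.

Lemma wp_visit a s : a < 8 -> a != aCnt -> rg s rP <= B -> ar s a (rg s rP) <= B ->
  rg s rOne = 1 -> rg s rZero = 0 ->
  wp W (visit a) 48 s (fun s' =>
    [/\ same s s', rg s' rP = rg s rP,
        ar s' aCnt = upd (ar s aCnt) (ar s a (rg s rP)) 0 &
        op s' = op s ++ unpairs (if (1 < ar s aCnt (ar s a (rg s rP))) &&
                                (rg s rI < ar s a (rg s rP))
                            then [:: (rg s rI, ar s a (rg s rP))] else [::])]).
Proof.
move=> a8 /negPf a2 pB xB one zero; apply: (@wp_seq _ _ _ 24 24); apply: wp_block => //.
  by rewrite /= /addr /upd /= /W; lia.
set s1 := adens _ _.
have sm1 : same s s1 by split=> // -[|[|[|]]].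
have x1 : rg s1 rX = ar s a (rg s rP) by [].
have k1 : rg s1 rK = ar s aCnt (ar s a (rg s rP)) - 1 by rewrite /s1 /= /upd /= one.
have p1 : rg s1 rP = rg s rP by [].
have c1 : ar s1 aCnt = upd (ar s aCnt) (ar s a (rg s rP)) 0 by rewrite /s1 /= /upd /= zero.
have o1 : op s1 = op s by [].
clearbody s1; apply: (@wp_if _ _ _ 21) => // hk.
  by split=> //; rewrite o1 ltnNge -subn_eq0 -k1 hk eqxx cats0.
apply: (wp_weaken (leqnn _) (@wp_print_if rI rX rX s1 isT isT isT isT)) => s2 [R2 A2 O2].
split; rewrite ?R2 ?A2 //.
- by apply: (same_trans sm1); split; rewrite ?R2 ?A2.
- case: sm1 => _ <- _ _ _; rewrite O2 x1 o1.
  by have -> : 1 < ar s aCnt (ar s a (rg s rP)) by rewrite -subn_gt0 -k1.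
Qed.

Lemma wp_print_heavy j s l : j <= B ->
  lrep (ar s aX1) (ar s aX2) (ar s aNx) j (rg s rP) l -> all small l ->
  rg s rOne = 1 -> rg s rZero = 0 ->
  (forall x, x \notin unpairs l -> ar s aCnt x = 0) ->
  wp W print_heavy (size l * 103 + 3) s (fun s' =>
    [/\ same s s', op s' = op s ++ unpairs (heavy (rg s rI) (ar s aCnt) (unpairs l)) &
        forall x, ar s' aCnt x = 0]).
Proof.
move=> jB lr ls one zero c0.
(* What has been printed, followed by what [heavy] prescribes for the rest with the current
   counters, is constant. *)
pose Inv n s' := exists l', [/\ size l' = n, same s s',
   op s' ++ unpairs (heavy (rg s rI) (ar s' aCnt) (unpairs l'))
     = op s ++ unpairs (heavy (rg s rI) (ar s aCnt) (unpairs l)),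
   lrep (ar s aX1) (ar s aX2) (ar s aNx) j (rg s' rP) l' &
   all small l' /\ forall x, x \notin unpairs l' -> ar s' aCnt x = 0].
apply: (@wp_weaken _ _ (\sum_(0 <= i < size l) 102.+1 + 3)) (fun=> id).
  by rewrite sum_nat_const_nat subn0.
apply: (wp_while (Inv := Inv)) => //; last first.
- by exists l; split=> //; split.
- move=> n s' [[|[x y] l'] [// [sz] sm ho [/andP[h0 hj] ex ey lr'] [/andP[/andP[xB yB] ls'] hc]]].
  rewrite /= in ex ey xB yB.
  split=> //; have [e0 e1 e2 e12 ea] := sm.
  rewrite one in e0; rewrite zero in e12; rewrite -!(ea aX1, ea aX2, ea aNx) // in ex ey lr'.
  apply: (@wp_seq _ _ _ 48 54).
  apply: wp_weaken (leqnn _) (wp_visit _ _ _ _ _ _) _; rewrite ?ex //; first lia.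
  move=> s1 [sm1 p1 c1 o1]; have [f0 f1 f2 f12 fa] := sm1.
  rewrite e0 in f0; rewrite e12 in f12.
  apply: (@wp_seq _ _ _ 48 6).
  apply: wp_weaken (leqnn _) (wp_visit _ _ _ _ _ _) _; rewrite ?p1 ?(fa aX2) ?ey //; first lia.
  move=> s2 [sm2 p2 c2 o2]; have [g0 g1 g2 g12 ga] := sm2.
  rewrite f0 in g0; rewrite f12 in g12.
  apply: wp_block => //.
    by rewrite /= /addr p2 /W; lia.
  exists l'; split=> //.
  + apply: (same_trans sm); apply: (same_trans sm1); apply: (same_trans sm2).
    by split=> // -[|[|[|]]].
  + by rewrite -ho unpairs_cons /= c2 c1 o2 o1 f1 e1 c1 !unpairs_cat !catA.
  + by rewrite /= /upd /= ga // fa // p2 -!(ea aX1, ea aX2, ea aNx).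
  + split=> // z zl; rewrite /= c2 c1 /upd.
    case: eqP => // zy; case: eqP => // zx; apply: hc.
    by rewrite unpairs_cons !inE !negb_or zl andbT; apply/andP; split; apply/eqP.
- move=> s' [[|? ?] [// _ sm ho r0 [_ hc]]]; split=> //; split=> // [|x].
    by rewrite -ho /= cats0.
  exact: hc.
Qed.

Lemma wp_print_pendant L j s : heap L j s -> j <= B -> rg s rI <= B ->
  (forall v, all small (L v)) ->
  wp W print_pendant 100 s (fun s' =>
    [/\ same s s', op s' = op s ++ unpairs (light L (rg s rI)) & ar s' aCnt = ar s aCnt]).
Proof.
move=> [hj one hl hd hs] jB vB Ls; set v := rg s rI in vB *.
apply: (@wp_seq _ _ _ 12 88); apply: wp_block => //.
  by rewrite /= /addr /upd /= -/v /W; lia.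
set s1 := adens _ _.
have sm1 : same s s1 by split.
have d1 : rg s1 rD = size (L v) by rewrite /s1 /= /upd /= hd.
have p1 : rg s1 rP = ar s aHd v by [].
have o1 : op s1 = op s by [].
have c1 : ar s1 aCnt = ar s aCnt by [].
clearbody s1; apply: (@wp_if _ _ _ 85) => // hD; rewrite d1 in hD.
  by split=> //; rewrite o1 /light (size0nil hD) cats0.
have [e0 e1 e2 e12 ea] := sm1.
apply: (@wp_seq _ _ _ 12 73); apply: wp_block => //.
  by rewrite /= e0 one.
set s2 := adens _ _.
have sm2 : same s s2 by apply: (same_trans sm1); split.
have d2 : rg s2 rD = 2 - size (L v) by rewrite /s2 /= /upd /= e0 one d1.
have p2 : rg s2 rP = ar s aHd v by rewrite -p1.
have o2 : op s2 = op s by rewrite -o1.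
have c2 : ar s2 aCnt = ar s aCnt by rewrite -c1.
clearbody s2; clear s1 sm1 d1 p1 o1 c1 e0 e1 e2 e12 ea.
have [e0 e1 e2 e12 ea] := sm2.
apply: (@wp_if _ _ _ 70) => // hD2; rewrite d2 in hD2.
  split=> //; rewrite o2 /light; case: (L v) hD hD2 => [|p [|p' l]] //=.
  by rewrite cats0.
have := hl v; have := Ls v; rewrite /light.
case: (L v) hD hD2 => [|[x y] [|? l]] //= _ _ /andP[/andP[/= xB yB] _] [/andP[h0 hj'] ex ey _].
apply: (@wp_seq _ _ _ 24 46); apply: wp_block => //.
  by rewrite /= /addr /upd /= p2 !(ea aX1, ea aX2) // ex ey /W; lia.
set s3 := adens _ _.
have sm3 : same s s3 by apply: (same_trans sm2); split.
have x3 : rg s3 rX = x by rewrite /s3 /= /upd /= p2 ea.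
have y3 : rg s3 rY = y by rewrite /s3 /= /upd /= p2 ea.
have tx3 : rg s3 rTX = size (L x) by rewrite /s3 /= /upd /= p2 !ea // ex hd.
have ty3 : rg s3 rTY = size (L y) by rewrite /s3 /= /upd /= p2 !ea // ey hd.
have i3 : rg s3 rI = v by rewrite /v -e1.
have o3 : op s3 = op s by rewrite -o2.
have c3 : ar s3 aCnt = ar s aCnt by rewrite -c2.
clearbody s3; apply: (@wp_seq _ _ _ 21 25).
apply: (wp_weaken (leqnn _) (@wp_print_if rTX rTY rX s3 isT isT isT isT)) => s4 [R4 A4 O4].
apply: (@wp_weaken _ _ 21 25 _ _ _ isT (@wp_print_if rTY rTX rY s4 isT isT isT isT)).
move=> s5 [R5 A5 O5]; split.
- by apply: (same_trans sm3); split; rewrite ?R5 ?R4 ?A5 ?A4.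
- by rewrite O5 O4 !R4 // x3 y3 tx3 ty3 i3 o3 -catA unpairs_cat.
- by rewrite A5 A4.
Qed.

(** Per list node, the two traversals cost 55 and 103 steps; the remaining 124 steps are rounded up
    to 200. *)
Lemma wp_process_vertex L j n s : heap L j s -> j <= B -> n <= B ->
  (forall v, all small (L v)) -> rg s rI = n.+1 -> rg s rZero = 0 ->
  (forall x, ar s aCnt x = 0) ->
  wp W process_vertex (200 + size (L n) * 158) s (fun s' =>
    [/\ heap L j s', rg s' rI = n, rg s' rZero = 0,
        forall x, ar s' aCnt x = 0 & op s' = op s ++ unpairs (found L n)]).
Proof.
move=> hp jB nB Ls iS z0 c0; have [_ one hl _ hs] := hp.
apply: (@wp_weaken _ _ (12 + ((size (L n) * 55 + 3) + (6 + ((size (L n) * 103 + 3) + 100))))) (fun=> id).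
  by lia.
apply: wp_seq; apply: wp_block => //.
  by rewrite /= /addr /upd /= iS one /W; lia.
set s1 := adens _ _.
have hp1 : heap L j s1 := hp.
have i1 : rg s1 rI = n by rewrite /s1 /= /upd /= iS one subn1.
have z1 : rg s1 rZero = 0 by [].
have c1 x : ar s1 aCnt x = 0 by exact: c0.
have o1 : op s1 = op s by [].
have p1 : rg s1 rP = ar s1 aHd n by rewrite -i1.
rewrite -o1; clearbody s1; clear s hp iS z0 c0 one hl o1.
have [_ one1 hl1 _ _] := hp1; have := hl1 n; rewrite -p1 => lr1.
have LnB : size (L n) <= B by apply: leq_trans jB.
apply: wp_seq; apply: (wp_weaken (leqnn _) (wp_count_neighbours hp1 jB lr1 (Ls n) LnB c1)).
move=> s2 [sm2 o2 c2]; have [e0 e1 _ ez ea] := sm2.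
apply: wp_seq; apply: wp_block => //.
  by rewrite /= /addr e1 i1 /W; lia.
set s3 := adens _ _.
have sm3 : same s1 s3 by apply: (same_trans sm2); split.
have p3 : rg s3 rP = rg s1 rP by rewrite /s3 /= /upd /= ea // e1 i1 p1.
have c3 x : ar s3 aCnt x = count_mem x (unpairs (L n)) := c2 x.
have o3 : op s3 = op s1 := o2.
clearbody s3; clear s2 sm2 o2 c2 e0 e1 ez ea; have [e0 e1 _ ez ea] := sm3.
rewrite -p3 -!(ea aX1, ea aX2, ea aNx) // in lr1; rewrite one1 in e0; rewrite z1 in ez.
rewrite i1 in e1.
have c3' x : x \notin unpairs (L n) -> ar s3 aCnt x = 0 by move=> xl; rewrite c3; apply/count_memPn.
apply: wp_seq; apply: (wp_weaken (leqnn _) (wp_print_heavy jB lr1 (Ls n) e0 ez c3')).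
move=> s4 [sm4 o4 c4]; have [f0 f1 _ fz fa] := sm4; rewrite e1 in f1 o4.
have hp4 : heap L j s4 by apply: heap_same sm4 _; apply: heap_same sm3 _.
have f1B : rg s4 rI <= B by rewrite f1.
apply: (wp_weaken (leqnn _) (wp_print_pendant hp4 jB f1B Ls)) => s5 [sm5 o5 c5].
have [_ g1 _ gz _] := sm5; split.
- exact: heap_same sm5 hp4.
- by rewrite g1.
- by rewrite gz fz.
- by move=> x; rewrite c5.
- by rewrite o5 o4 o3 f1 -catA -unpairs_cat (eq_heavy _ _ c3).
Qed.

Lemma wp_vertices L j n s : heap L j s -> j <= B -> n <= B ->
  (forall v, all small (L v)) -> rg s rI = n -> rg s rZero = 0 ->
  (forall x, ar s aCnt x = 0) ->
  wp W (While rI process_vertex) (n * 201 + (\sum_(0 <= v < n) size (L v)) * 158 + 3) s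
    (fun s' => op s' = op s ++ unpairs (all_found L n)).
Proof.
move=> hp jB nB Ls hi hz hc.
pose Inv n' s' := [/\ heap L j s', n' <= B, rg s' rI = n', rg s' rZero = 0 &
   (forall x, ar s' aCnt x = 0) /\
   op s' ++ unpairs (all_found L n') = op s ++ unpairs (all_found L n)].
apply: (@wp_weaken _ _ (\sum_(0 <= v < n) (200 + size (L v) * 158).+1 + 3)) (fun=> id).
  under eq_bigr do rewrite -addSn.
  by rewrite big_split sum_nat_const_nat subn0 -big_distrl.
apply: (wp_while (Inv := Inv)) => //.
  by move=> s' [_ _ -> _ [_ <-]]; split=> //; rewrite cats0.
move=> n' s' [hp' n'B hi' hz' [hc' ho']]; split; first by rewrite hi'.
apply: (wp_weaken (leqnn _) (wp_process_vertex hp' jB _ Ls hi' hz' hc')); first exact: ltnW.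
move=> s2 [hp2 i2 z2 c2 o2]; split=> //; first exact: ltnW.
by split=> //; rewrite -ho' o2 /= unpairs_cat catA.
Qed.

End Program.

(** * Correctness of the printed edges *)

Definition is_triple (t : seq nat) : bool := (size t == 3) && uniq t.

Lemma is_tripleP t : is_triple t -> exists a b c,
  [/\ t = [:: a; b; c], a != b, a != c & b != c].
Proof.
case: t => [|a [|b [|c [|]]]] //; rewrite /is_triple /= !inE negb_or.
by case/and3P=> /andP[ab ac] bc _; exists a, b, c.
Qed.

Lemma size_link v t : is_triple t -> size (link v t) = (v \in t).
Proof.
case/is_tripleP => a [b [c [-> _ _ _]]]; rewrite /= !inE.
by case: (v == c); case: (v == b); case: (v == a).
Qed.

Lemma count_link v x t : is_triple t -> x != v ->
  count_mem x (unpairs (link v t)) = (v \in t) && (x \in t).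
Proof.
case/is_tripleP => a [b [c [-> ab ac bc]]] xv; rewrite /= !inE.
have two (u w : nat) : u != w -> count_mem x (unpairs [:: (u, w)]) = (x == u) || (x == w).
  by move=> uw; rewrite /= (eq_sym u) (eq_sym w); case: eqVneq => [->|]; rewrite ?(negPf uw) ?addn0.
case: (eqVneq v c) xv => [->|vc] xv; first by rewrite two // !orbT (negPf xv) orbF.
case: (eqVneq v b) xv => [->|vb] xv; first by rewrite two // orbT (negPf xv).
by case: (eqVneq v a) xv => [->|va] xv //; rewrite two // (negPf xv).
Qed.

Lemma mem_link v t p : is_triple t -> p \in link v t -> t =i [:: v; p.1; p.2].
Proof.
case/is_tripleP => a [b [c [-> _ _ _]]] /=.
case: eqP => [->|_]; last case: eqP => [->|_]; last case: eqP => [->|_] //;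
  by rewrite inE => /eqP-> /= z; rewrite !inE; do !bool_congr.
Qed.

(** The order of the recorded pair depends on how the input lists the triple, so either order must
    be allowed. *)
Lemma link_mem v x y t : is_triple t -> t =i [:: v; x; y] ->
  ((x, y) \in link v t) || ((y, x) \in link v t).
Proof.
case/is_tripleP => a [b [c [-> ab ac bc]]] e.
have := e a; have := e b; have := e c; have := e v.
rewrite /= !inE !eqxx ?orbT /= => /or3P[] /eqP Ev; subst v;
  rewrite ?eqxx ?(negPf ab) ?(negPf ac) ?(negPf bc) ?(eq_sym b a) ?(eq_sym c a) ?(eq_sym c b)
    ?(negPf ab) ?(negPf ac) ?(negPf bc) /=.
- move=> /esym/orP[] /eqP ? /esym/orP[] /eqP ? _; subst; rewrite ?eqxx // in bc *;
  by rewrite !inE !eqxx ?orbT.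
- move=> /esym/orP[] /eqP ? _ /esym/orP[] /eqP ?; subst; rewrite ?eqxx // in ac *;
  by rewrite !inE !eqxx ?orbT.
- move=> _ /esym/orP[] /eqP ? /esym/orP[] /eqP ?; subst; rewrite ?eqxx // in ab *;
  by rewrite !inE !eqxx ?orbT.
Qed.

(** * Counting in the companion lists of a list of triples *)

Section Links.
Variable ds : seq (seq nat).
Hypothesis dsP : all is_triple ds.

Lemma size_links v : size (links ds v) = count (fun t => v \in t) ds.
Proof.
elim: ds dsP => //= t d IH /andP[tP /IH e].
by rewrite links_cons size_cat size_link // e.
Qed.

Lemma count_links v x : x != v ->
  count_mem x (unpairs (links ds v)) = count (fun t => (v \in t) && (x \in t)) ds.
Proof.
move=> xv; elim: ds dsP => //= t d IH /andP[tP /IH e].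
by rewrite links_cons unpairs_cat count_cat count_link // e.
Qed.

Lemma mem_links v p : p \in links ds v -> exists2 t, t \in ds & t =i [:: v; p.1; p.2].
Proof.
case/flatten_mapP => t td /(mem_link (allP dsP _ td)) e; by exists t.
Qed.

Lemma links_mem v x y t : t \in ds -> t =i [:: v; x; y] ->
  ((x, y) \in links ds v) || ((y, x) \in links ds v).
Proof.
move=> td /(link_mem (allP dsP _ td)) /orP[] h; apply/orP; [left|right];
  by apply/flatten_mapP; exists t.
Qed.

Lemma mem_unpairs_links v x : x \in unpairs (links ds v) ->
  exists t, [/\ t \in ds, v \in t & x \in t].
Proof.
case/flatten_mapP => p /mem_links[t td e] xp; exists t; split=> //.
  by rewrite e !inE eqxx.
by rewrite e inE xp orbT.
Qed.

(** Otherwise the three distinct members of a triple would be among two companions. *)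
Lemma links_irrefl v : v \notin unpairs (links ds v).
Proof.
apply/negP => /flatten_mapP[p /mem_links[t td e] vp].
have /andP[/eqP t3 tu] := allP dsP _ td.
suff : size t <= size [:: p.1; p.2] by rewrite t3.
by apply: uniq_leq_size => // z; rewrite e in_cons => /orP[/eqP->|].
Qed.

(** Double counting: a triple adds one entry to the list of each of its three members. This makes
    the total running time linear. *)
Lemma sum_size_links n : \sum_(0 <= v < n) size (links ds v) <= 3 * size ds.
Proof.
elim: ds dsP => [|t d IH] /=; first by rewrite big1.
case/andP => tP /IH h; under eq_bigr do rewrite links_cons size_cat size_link //.
rewrite big_split mulnS leq_add //=; case/is_tripleP: tP => a [b [c [-> _ _ _]]].
have one x : \sum_(0 <= v < n) (v == x : nat) <= 1.
  rewrite -big_mkcond sum1_count; apply: leq_trans (leq_b1 (x \in index_iota 0 n)).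
  by rewrite -count_uniq_mem ?iota_uniq.
apply: (@leq_trans (\sum_(0 <= v < n) ((v == a : nat) + (v == b) + (v == c)))).
  by apply: leq_sum => v _; rewrite !inE; case: (v == a); case: (v == b); case: (v == c).
by rewrite !big_split /=; have := one a; have := one b; have := one c; lia.
Qed.

End Links.

(** Clearing the counter of [x] affects only later occurrences of [x], and the first one has already
    decided whether it is reported. *)
Lemma mem_heavy v cnt q p :
  (p \in heavy v cnt q) = [&& p.1 == v, p.2 \in q, 1 < cnt p.2 & v < p.2].
Proof.
case: p => u y; elim: q cnt => [|x q IH] cnt /=; first by rewrite andbF.
rewrite mem_cat IH inE /upd /=.
have [->|yx] := eqVneq y x; rewrite /= ?andbF ?orbF.
  case: (1 < cnt x); case: (v < x); rewrite ?andbF //= inE xpair_eqE eqxx !andbT //.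
case: ifP => //= _; by rewrite inE xpair_eqE (negPf yx) andbF.
Qed.

Lemma uniq_heavy v cnt q : uniq (heavy v cnt q).
Proof.
elim: q cnt => //= x q IH cnt; rewrite cat_uniq IH andbT.
apply/andP; split; first by case: ifP.
apply/hasPn => p; rewrite mem_heavy /upd => /and4P[_ _ h _].
by case: ifP => //= _; rewrite inE; apply: contraTN h => /eqP->; rewrite eqxx.
Qed.

Lemma mem_light L v p : (p \in light L v) =
  (p.1 == v) && (if L v is [:: q] then
      (p.2 == q.1) && (size (L q.1) < size (L q.2)) ||
      (p.2 == q.2) && (size (L q.2) < size (L q.1)) else false).
Proof.
rewrite /light; case: (L v) => [|q [|? ?]]; rewrite ?andbF //.
rewrite mem_cat; case: p => u x /=.
by case: (ltngtP (size (L q.1))) => _; rewrite ?inE ?xpair_eqE ?andbT ?andbF ?orbF.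
Qed.

Lemma found_fst L v p : p \in found L v -> p.1 = v.
Proof. by rewrite mem_cat mem_heavy mem_light => /orP[]/andP[/eqP]. Qed.

Lemma mem_all_found L n p : (p \in all_found L n) = (p.1 < n) && (p \in found L p.1).
Proof.
elim: n => //= n IH; rewrite mem_cat IH ltnS.
have [->|ne] := eqVneq p.1 n; first by rewrite ltnn orbF leqnn.
rewrite [p.1 <= n]leq_eqVlt (negPf ne) /=.
by case: (boolP (p \in found L n)) => // /found_fst pn; rewrite pn eqxx in ne.
Qed.

Lemma uniq_all_found L n : (forall v, uniq (found L v)) -> uniq (all_found L n).
Proof.
move=> u; elim: n => //= n IH; rewrite cat_uniq u IH andbT /=.
apply/hasPn => p; rewrite mem_all_found => /andP[lt _].
by apply: contraTN lt => /found_fst ->; rewrite ltnn.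
Qed.

(** The two parts are disjoint: [light] is nonempty only for a list of length 1, in which no
    companion occurs twice, as [heavy] would require. *)
Lemma uniq_found ds v : all is_triple ds -> uniq (found (links ds) v).
Proof.
move=> dsP; rewrite cat_uniq uniq_heavy /=; apply/andP; split.
  apply/hasPn => p; rewrite mem_light mem_heavy => /andP[_].
  case E: (links ds v) => [|q [|? ?]] // _; apply: contraTN isT => /and4P[_ px + _].
  rewrite -E count_links //; last first.
    by apply: contraTneq px => ->; rewrite -E links_irrefl.
  rewrite ltnNge; case/negP; apply: (@leq_trans (size (links ds v))); last by rewrite E.
  by rewrite size_links //; apply: sub_count => t /andP[].
by rewrite /light; case: (links ds v) => [|q [|? ?]] //; case: ltngtP.
Qed.

Lemma reconstruct_computes ts : all is_triple ts -> 0 < size ts ->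
  all (all (geq (3 * size ts))) ts ->
  computes_within (compile 0 reconstruct) (1300 * size ts) (1300 * size ts)
    (size ts :: flatten ts) (unpairs (all_found (links (rev ts)) (3 * size ts))).
Proof.
move=> tsP ts0 tsB; set m := size ts in ts0 tsB *.
have rP : all is_triple (rev ts) by rewrite all_rev.
have weak : wp (32 + 8 * (3 * m)) reconstruct (1300 * m)
    (State (fun=> 0) (fun _ _ => 0) (m :: flatten ts) [::])
    (fun s => op s = unpairs (all_found (links (rev ts)) (3 * m))).
  apply: (@wp_weaken _ _ (24 + ((m * 187 + 3) + ((3 * m) * 201 +
     (\sum_(0 <= v < 3 * m) size (links (rev ts) v)) * 158 + 3)))) (fun=> id).
    (* The total is at most [1264 * m + 30], where 1264 is 187 + 603 + 474, and 30 is at most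
       [36 * m]. *)
    by have := sum_size_links rP (3 * m); rewrite size_rev -/m; lia.
  apply: wp_seq; apply: wp_block => //; first by rewrite /= /upd /=; lia.
  set s1 := adens _ _.
  have hp1 : heap (fun=> [::]) 0 s1 by [].
  have i1 : rg s1 1 = 3 * m by rewrite /s1 /= /upd /=; lia.
  have tP3 : all (fun t => [&& size t == 3, uniq t & all (geq (3 * m)) t]) ts.
    apply/allP => t tt; have /andP[-> ->] := allP tsP _ tt; exact: (allP tsB _ tt).
  apply: wp_seq.
  apply: (wp_weaken (leqnn _) (@wp_read_triples (3 * m) ts s1 _ _ _ _ _)) => //.
  move=> s2 [hp2 i2 z2 c2 o2]; rewrite i1 in i2.
  apply: (wp_weaken (leqnn _) (@wp_vertices (3 * m) _ _ _ s2 hp2 _ _ _ i2 _ _)) => //.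
  - move=> v; apply/allP => p /(mem_links rP)[t]; rewrite mem_rev => tt e.
    have /allP tb := allP tsB _ tt.
    by apply/andP; split; apply: tb; rewrite e !inE eqxx ?orbT.
  - by move=> x; rewrite c2.
  - by move=> s3 ->; rewrite o2.
have [h1 h2 h3] := wp_computes (isT : 0 < 32 + 8 * (3 * m)) weak (fun s => id).
by split=> // k a; apply: leq_trans (h3 k a) _; lia.
Qed.

(** * From printed names back to the edges of the tree *)

Section Glue.
Variables (V : finType) (G : sgraph V) (lab : V -> nat) (ts : seq (seq V)).
Hypotheses (treeG : is_tree G) (V5 : 5 <= #|V|) (lab_inj : injective lab).
Hypotheses (lab_lt : forall v, lab v < #|V|) (tsP : listing (connected_triples G) ts).
Local Notation T := (connected_triples G).

Let tn := [seq map lab s | s <- ts].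
Let ds := rev tn.

Lemma listing_mem F (ss : seq (seq V)) (s : seq V) : listing F ss -> s \in ss ->
  [set x in s] \in F.
Proof.
case=> _ /perm_mem e ss_s; rewrite -mem_enum -e.
exact: (map_f (fun s : seq V => [set x in s])).
Qed.

Lemma listing_count F (ss : seq (seq V)) (P : pred {set V}) : listing F ss ->
  count (fun s => P [set x in s]) ss = #|[set t in F | P t]|.
Proof.
case=> _ /permP/(_ P); rewrite count_map => ->.
rewrite cardE -size_filter /enum_mem -filter_predI; congr size.
by apply: eq_filter => t; rewrite !inE andbC.
Qed.

Lemma triple_names : all is_triple ds.
Proof.
rewrite all_rev; apply/allP => _ /mapP[s sts ->]; rewrite /is_triple size_map map_inj_uniq //.
have su := allP (proj1 tsP) _ sts; rewrite su andbT.
by have := listing_mem tsP sts; rewrite inE cardsE (card_uniqP su) => /andP[].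
Qed.

Lemma size_links_lab a : size (links ds (lab a)) = tdeg T a.
Proof.
rewrite size_links ?triple_names // /ds count_rev count_map.
rewrite /tdeg -(listing_count (fun t : {set V} => a \in t) tsP).
by apply: eq_count => s; rewrite /= mem_map // inE.
Qed.

Lemma count_links_lab a b : a != b ->
  count_mem (lab b) (unpairs (links ds (lab a))) = codeg T a b.
Proof.
move=> ab; rewrite count_links ?triple_names ?inj_eq 1?eq_sym // /ds count_rev count_map.
rewrite /codeg -(listing_count (fun t : {set V} => (a \in t) && (b \in t)) tsP).
by apply: eq_count => s; rewrite /= !mem_map // !inE.
Qed.

Lemma mem_triple_names t : t \in ds -> exists2 s, s \in ts & t = map lab s.
Proof. by rewrite mem_rev => /mapP. Qed.

(** The loop also visits numbers that name no vertex, but whatever is printed for [v] comes from a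
    triple containing [v] and [x]. *)
Lemma found_names v x : (v, x) \in found (links ds) v -> exists a b, v = lab a /\ x = lab b.
Proof.
have P := triple_names.
suff main t : t \in ds -> v \in t -> x \in t -> exists a b, v = lab a /\ x = lab b.
  rewrite mem_cat mem_heavy mem_light /= !eqxx /= => /orP[/and3P[]|].
    by move=> /(mem_unpairs_links P)[t [td vt xt]] _ _; apply: (main t).
  case E: (links ds v) => [|q [|? ?]] // h.
  have [t td e] : exists2 t, t \in ds & t =i [:: v; q.1; q.2].
    by apply: (mem_links P); rewrite E inE.
  apply: (main t td); rewrite e !inE ?eqxx //.
  by case/orP: h => /andP[-> _]; rewrite ?orbT.
by move=> /mem_triple_names[s _ ->] /mapP[a _ ->] /mapP[b _ ->]; exists a, b.
Qed.

(** Counters give [codeg] and list lengths give [tdeg]. A list of length 1 may hold its two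
    companions in either order, which the two comparisons of [light] account for. *)
Lemma found_lab a b : (lab a, lab b) \in found (links ds) (lab a) =
  [&& a != b, 1 < codeg T a b & lab a < lab b] || pendant T a b.
Proof.
have P := triple_names.
rewrite mem_cat mem_heavy mem_light /= eqxx /=; congr (_ || _).
  have [<-|ab] := eqVneq a b; first by rewrite ltnn !andbF.
  rewrite count_links_lab //= ; case c1: (1 < codeg T a b) => //=; last by rewrite andbF.
  suff -> : lab b \in unpairs (links ds (lab a)) by [].
  by rewrite -has_pred1 has_count count_links_lab // ltnW.
rewrite /pendant -size_links_lab; apply/idP/andP.
  case E: (links ds (lab a)) => [|q [|? ?]] // h; split=> //.
  have [t td e] : exists2 t, t \in ds & t =i [:: lab a; q.1; q.2].
    by apply: (mem_links P); rewrite E inE.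
  have [s sts et] := mem_triple_names td.
  have q1 : q.1 \in t by rewrite e !inE eqxx orbT.
  have q2 : q.2 \in t by rewrite e !inE eqxx !orbT.
  move: q1 q2; rewrite et => /mapP[y _ y1] /mapP[z _ z2].
  have sT : [set a; y; z] \in T.
    suff <- : [set x in s] = [set a; y; z] by apply: listing_mem tsP sts.
    apply/setP => u; rewrite !inE -(mem_map lab_inj) -et e !inE y1 z2 !inj_eq //.
    by rewrite orbA.
  rewrite y1 z2 !size_links_lab !inj_eq // in h.
  apply/existsP; case/orP: h => /andP[/eqP-> lt]; [exists z|exists y]; rewrite lt andbT //.
  by rewrite set3_swap.
case=> /eqP L1 /existsP[z /andP[sT lt]].
have [s sts es] : exists2 s, s \in ts & [set a; b; z] = [set x in s].
  by apply/mapP; rewrite (perm_mem (proj2 tsP)) mem_enum.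
have sd : map lab s \in ds by rewrite mem_rev map_f.
have e : map lab s =i [:: lab a; lab b; lab z].
  move=> n; apply/mapP/idP => [[x xs ->]|].
    have : x \in [set a; b; z] by rewrite es inE.
    by rewrite !inE !inj_eq // orbA.
  have in3 x : x \in [set a; b; z] -> x \in s by rewrite es inE.
  by rewrite !inE => /or3P[] /eqP->; [exists a|exists b|exists z]; rewrite // in3 // !inE eqxx ?orbT.
have := links_mem P sd e.
case: (links ds (lab a)) L1 => [|q [|? ?]] // _; rewrite !inE.
by case/orP => /eqP <- /=; rewrite !eqxx !size_links_lab lt ?orbT.
Qed.

Lemma reconstruct_tree : exists2 es : seq (seq V), listing (edges G) es &
  computes_within (compile 0 reconstruct) (1300 * #|T|) (1300 * #|T|)
    (size ts :: encode lab ts) (encode lab es).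
Proof.
have P := triple_names.
have sz : size ts = #|T| by rewrite cardE -(perm_size (proj2 tsP)) size_map.
have VT : #|V| <= 3 * #|T| := card_tree_le treeG V5.
have /card_gt0P[x0 _] : 0 < #|V| by apply: leq_trans V5.
(* A left inverse of [lab], with default [x0] on numbers that are not names. *)
pose g n := odflt x0 [pick v | lab v == n].
have gK v : g (lab v) = v.
  by rewrite /g; case: pickP => [w /eqP/lab_inj //|/(_ v)]; rewrite eqxx.
pose E := all_found (links ds) (3 * #|T|).
have Elab p : p \in E -> exists a b, p = (lab a, lab b).
  case: p => v x; rewrite mem_all_found => /andP[_ /found_names[a [b [-> ->]]]].
  by exists a, b.
have memE a b : ((lab a, lab b) \in E) =
    [&& a != b, 1 < codeg T a b & lab a < lab b] || pendant T a b.
  by rewrite mem_all_found found_lab /= (leq_trans (lab_lt a)).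
have E_adj a b : (lab a, lab b) \in E -> adj G a b.
  rewrite memE (adj_recognition treeG) // => /orP[/and3P[-> -> _] //|pab].
  by rewrite pab orbT (adj_neq (pendant_adj treeG V5 pab)).
(* Each edge is printed in one orientation: heavy ones by the order of names, pendant ones by
   [pendant_asym], and no edge is of both kinds since a pendant one has [codeg] at most 1. *)
have E_asym a b : (lab a, lab b) \in E -> (lab b, lab a) \notin E.
  have excl c d : pendant T c d -> 1 < codeg T c d = false.
    by case/andP=> /eqP tc _; rewrite ltnNge -tc codeg_le.
  rewrite !memE => /orP[/and3P[ab cab lt]|pab]; rewrite negb_or.
    apply/andP; split; apply/negP; first by case/and3P => _ _; lia.
    by move=> /excl; rewrite codegC cab.
  by rewrite codegC excl // andbF (pendant_asym treeG V5 pab).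
exists [seq [:: g p.1; g p.2] | p <- E].
  split; first by apply/allP => _ /mapP[p /[dup] /Elab[a [b ->]] /E_adj/adj_neq + ->];
    rewrite /= !gK inE andbT.
  rewrite -map_comp; apply: uniq_perm; rewrite ?enum_uniq //.
    (* Pairs with the same underlying set are equal or swapped, and [E_asym] rules out the swap. *)
    rewrite map_inj_in_uniq; first by apply: uniq_all_found => v; apply: uniq_found.
    move=> p q /[dup] /Elab[a [b ->]] abE /[dup] /Elab[c [d ->]] cdE /=; rewrite !gK => eq2.
    have set2 u w : [set x in [:: u; w]] = [set u; w] :> {set V}.
      by apply/setP => x; rewrite !inE.
    rewrite !set2 in eq2; have ab := adj_neq (E_adj _ _ abE).
    have /setP e := eq2; have := e a; have := e b; have := e c; have := e d.
    rewrite !inE !eqxx ?orbT /= => hd hc /esym hb /esym /orP[]/eqP ha; subst.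
      by move: hb; rewrite eq_sym (negPf ab) => /eqP->.
    move: hb; rewrite [b == d]eq_sym (negPf ab) orbF => /eqP hb; subst.
    by have := E_asym _ _ abE; rewrite cdE.
  move=> e; rewrite mem_enum; apply/mapP/idP.
    case=> p /[dup] /Elab[a [b ->]] /E_adj + ->; rewrite /= !gK /adj.
    suff -> : [set x in [:: a; b]] = [set a; b] :> {set V} by [].
    by apply/setP => x; rewrite !inE.
  move=> eE; have /forall_inP/(_ _ eE)/cards2P[x [y [xy Ee]]] := edges_card2 G.
  have : adj G x y by rewrite /adj -Ee.
  rewrite (adj_recognition treeG V5) => /andP[_ h].
  suff : ((lab x, lab y) \in E) || ((lab y, lab x) \in E).
    case/orP => h'; [exists (lab x, lab y)|exists (lab y, lab x)] => //=; rewrite !gK Ee;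
      by apply/setP => z; rewrite !inE // orbC.
  rewrite !memE codegC xy eq_sym xy /= codegC.
  case/or3P: h => [c|->|->]; rewrite ?orbT //.
  rewrite c /=; have : lab x != lab y by rewrite inj_eq.
  by case: ltngtP; rewrite ?orbT.
have -> : encode lab [seq [:: g p.1; g p.2] | p <- E] = unpairs E.
  rewrite /encode map_flatten -map_comp; congr flatten; apply/eq_in_map => p /Elab[a [b ->]].
  by rewrite /= !gK.
have -> : encode lab ts = flatten tn by rewrite /encode map_flatten.
have szn : size tn = #|T| by rewrite size_map.
rewrite /E sz -szn; apply: reconstruct_computes.
- by rewrite -all_rev.
- by rewrite szn; lia.
- apply/allP => _ /mapP[s _ ->]; apply/allP => _ /mapP[v _ ->] /=.
  by rewrite szn (leq_trans _ VT) // ltnW.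
Qed.

End Glue.

Theorem theorem1 :
  (forall (V : finType) (G : sgraph V), is_tree G -> 5 <= #|V| ->
     unique (fun H : sgraph V =>
       is_tree H /\ connected_triples H = connected_triples G) G) /\
  (exists p : seq instr, reconstructs_in_linear_time p).
Proof.
split.
  move=> V G tG V5; split=> // H [tH eqT]; exact: tree_triples_inj.
exists (compile 0 reconstruct), 1300 => V G lab ts tG V5 inj lt lts.
exact: reconstruct_tree.
Qed.
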